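(* Let $m\ge 1$ and $n\geq 3$ be integers, let $P_d(f)$ denote an algebraic differential polynomial in $f$ of degree $d\leq n-2$, let $p$ be a non-zero polynomial in $\mathbb{C}^m$, and let $\alpha=(\alpha_1,\ldots,\alpha_m)\in\mathbb{C}^m$ with $\alpha\neq(0,\ldots,0)$. Then the partial differential equation $$f^n(z)+P_d(f(z))=p(z)e^{\langle \alpha,\overline{z}\rangle}$$ has transcendental entire solutions $f$ in $\mathbb{C}^m$, and the solutions are $f(z)=q(z)e^{\langle\alpha,\overline{z}\rangle/n}$, where $q(z)$ is a polynomial in $\mathbb{C}^m$ such that $q^n(z)=p(z)$. In this case $P_d(f)\equiv 0$.
   Context: Notation: for $\alpha\in\mathbb{C}^m$ and $z=(z_1,\ldots,z_m)\in\mathbb{C}^m$, $\langle\alpha,\overline{z}\rangle=\sum_{k=1}^m\alpha_k z_k$. For a multi-index $I=(i_1,\ldots,i_m)\in\mathbb{Z}_{\ge 0}^m$, $\partial^I=\frac{\partial^{|I|}}{\partial z_1^{i_1}\cdots\partial z_m^{i_m}}$ with $|I|=i_1+\cdots+i_m$. Algebraic differential polynomial: given distinct multi-indices $\nu_1,\ldots,\nu_N\in\mathbb{Z}_{\geq 0}^m$ with $0<|\nu_1|\le\cdots\le|\nu_N|$, an algebraic differential polynomial in $f$ is a finite sum $P_d(f)=\sum_{i\in I}c_i\, f^{i_0}(\partial^{\nu_1}(f))^{i_1}\cdots(\partial^{\nu_N}(f))^{i_N}$, where $I$ is a finite set of distinct elements $i=(i_0,\ldots,i_N)\in\mathbb{Z}_{\ge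 0}^{N+1}$ and the coefficients $c_i$ are polynomials in $z\in\mathbb{C}^m$. Its degree is $d=\max_{i\in I}(i_0+i_1+\cdots+i_N)$. An entire function in $\mathbb{C}^m$ is a holomorphic function $\mathbb{C}^m\to\mathbb{C}$; it is transcendental if it is not a polynomial.
   Formalization: Existence of transcendental entire solutions is not unconditional (f^3 = z e^z has none): it is proved equivalent to some polynomial q having q^n = p and P_d(q e^{<α,z̄>/n}) ≡ 0, and ''the solutions are all such q e^{<α,z̄>/n}'' is stated for the case that solutions exist. *)

(* Defs.v *)
From HB Require Import structures.
From mathcomp Require Import all_boot all_order all_algebra.
From mathcomp Require Import complex.
(* Only the coercions and canonical instances of mpoly are imported: its notations clash with those of MathComp-Analysis. *)
From mathcomp Require mpoly.
Import (coercions, canonicals) mpoly.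
From mathcomp Require Import all_classical all_reals all_analysis.

Set Implicit Arguments.
Unset Strict Implicit.
Unset Printing Implicit Defensive.

Import Order.TTheory GRing.Theory Num.Theory.
Import numFieldNormedType.Exports.

Local Open Scope ring_scope.

(* Naming the structure lets C R inherit the topology that MathComp-Analysis
   puts on every numClosedFieldType; R[i] itself carries no such instance. *)
Definition C (R : realType) : numClosedFieldType := R[i].

Definition cexp (R : realType) (z : C R) : C R :=
  (expR (complex.Re z) * cos (complex.Im z)
   +i* (expR (complex.Re z) * sin (complex.Im z)))%C.

Notation mindex := mpoly.multinom.

Definition cpoly (R : realType) (m : nat) := mpoly.mpoly m (C R).

Definition peval (R : realType) (m : nat) (p : cpoly R m) (z : 'rV[C R]_m) : C R :=
  mpoly.meval (fun k => z 0 k) p.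

(* <alpha, conj z> for the Hermitian product: the two conjugations cancel. *)
Definition pairing (R : realType) (m : nat) (alpha z : 'rV[C R]_m) : C R :=
  \sum_(k < m) alpha 0 k * z 0 k.

(* Differentiability is over the complex scalars, hence holomorphy. *)
Definition entire (R : realType) (m : nat) (f : 'rV[C R]_m -> C R) : Prop :=
  forall z, differentiable f z.

Definition transcendental (R : realType) (m : nat) (f : 'rV[C R]_m -> C R) : Prop :=
  ~ exists p : cpoly R m, forall z, f z = peval p z.

Definition pderiv (R : realType) (m : nat) (k : 'I_m)
    (f : 'rV[C R]_m -> C R) : 'rV[C R]_m -> C R :=
  fun z => 'D_(delta_mx 0 k) f z.

(* The variables are differentiated in a fixed order, which is immaterial for
   entire f. *)
Definition pderivm (R : realType) (m : nat) (nu : mindex m)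
    (f : 'rV[C R]_m -> C R) : 'rV[C R]_m -> C R :=
  foldr (fun k g => iter (nu k) (pderiv k) g) f (enum 'I_m).

(* sum over i in dp_I of c_i f^(i_0) (d^(nu_1) f)^(i_1) ... (d^(nu_N) f)^(i_N);
   only the values of dp_c on dp_I matter. *)
Record diffpoly (R : realType) (m : nat) := DiffPoly {
  dp_N : nat;
  dp_nu : 'I_dp_N -> mindex m;
  dp_nu_inj : injective dp_nu;
  dp_nu_gt0 : forall j, (0 < mpoly.mdeg (dp_nu j))%N;
  dp_nu_le : forall j k : 'I_dp_N, (j <= k)%N ->
    (mpoly.mdeg (dp_nu j) <= mpoly.mdeg (dp_nu k))%N;
  dp_I : seq (mindex dp_N.+1);
  dp_I_uniq : uniq dp_I;
  dp_c : mindex dp_N.+1 -> cpoly R m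
}.

Arguments dp_nu {R m} d _.
Arguments dp_c {R m} d _.

Definition dp_deg (R : realType) (m : nat) (P : diffpoly R m) : nat :=
  \max_(i <- dp_I P) mpoly.mdeg i.

(* In i = (i_0, ..., i_N), i_0 is i ord0 and i_(j+1) is i (lift ord0 j). *)
Definition dp_eval (R : realType) (m : nat) (P : diffpoly R m)
    (f : 'rV[C R]_m -> C R) (z : 'rV[C R]_m) : C R :=
  \sum_(i <- dp_I P)
    peval (dp_c P i) z * f z ^+ i ord0 *
    \prod_(j < dp_N P) pderivm (dp_nu P j) f z ^+ i (lift ord0 j).

Definition trans_entire_sol (R : realType) (m n : nat) (P : diffpoly R m)
    (p : cpoly R m) (alpha : 'rV[C R]_m) (f : 'rV[C R]_m -> C R) : Prop :=
  [/\ entire f, transcendental f &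
      forall z, f z ^+ n + dp_eval P f z = peval p z * cexp (pairing alpha z)].

(* Main.v *)
(* Write L = <alpha, conj z> and N = n - 2, and let f be an entire solution. If |f(z0)|
   exceeded a large polynomial multiple of exp((Re L(z0))^+ / n), the equation and
   Cauchy's estimates would give points near z0 at which |f| is arbitrarily large; so
   |f| is bounded by such a multiple everywhere. On a complex line along which L has
   slope 1, write u = f, w = P_d(f) and p e^L = pi e^t with pi a polynomial, so that
   u^n + w = pi e^t, and set phi = n pi u' - (pi' + pi) u. Then
   u^(n-1) phi = (pi' + pi) w - pi w' grows at most like e^(N (Re t)^+ / n), which makes
   phi of polynomial growth and convergent to 0 along the positive axis: phi = 0 by
   Liouville's theorem. Hence w e^(-t) / pi is constant along a ray avoiding the
   zeros of pi, and it tends to 0 there. Thus P_d(f) = 0 and f^n = p e^L, and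
   f e^(-L/n), being entire of polynomial growth, is a polynomial. Conversely, two
   n-th roots q of p differ by a root of unity e^c, and P_d(e^c f) vanishes with
   P_d(f) because f = q e^(L/n) makes each homogeneous part of P_d(f) vanish. *)
Require Import Defs.
From HB Require Import structures.
From mathcomp Require Import all_boot all_order all_algebra.
From mathcomp Require Import complex.
From mathcomp Require mpoly.
Import (coercions, canonicals) mpoly.
From mathcomp Require Import all_classical all_reals all_analysis.
From mathcomp Require Import ring lra.

Set Implicit Arguments.
Unset Strict Implicit.
Unset Printing Implicit Defensive.

Import Order.TTheory GRing.Theory Num.Theory.
Import numFieldNormedType.Exports.

Local Open Scope ring_scope.

(** * Complex differentiation and the exponential *)

Section Modulus.
Local Open Scope classical_set_scope.
Context {R : realType}.
Implicit Types z w : C R.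

(** The bound d <= n - 2 acts through phi. Where the exponential dominates, |u| is comparable to
    e^(Re t / n) up to polynomial factors, so u^(n-1) phi, of size at most e^((n-2) Re t / n),
    leaves a full factor e^(- Re t / n) of decay for phi; with d = n - 1 only polynomial boundedness
    would remain. The obstacle before that is the growth of f, about which nothing is known
    beforehand. In P_d(f), derivatives cost negative powers of the radius on which Cauchy's
    estimates are taken, but at most d powers of the local maximum of |f|, fewer than n. Radii 2^-j
    with finite sum pay for the negative powers: a value of |f| that is too large would force a
    geometric increase along a sequence that stays in a bounded set. Cauchy's formula comes from
    Goursat's theorem on rectangles: the exponential pulls circles back to vertical segments, so
    that only integrals over real intervals occur. *)

Definition cabs z : R := complex.Re `|z|.

(** The norm of [C R] has its values in [C R], whose order is partial; [cabs] moves every estimate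
    to the totally ordered field [R]. *)
Lemma normr_cabs z : `|z| = real_complex R (cabs z).
Proof. by rewrite /cabs; have /ger0_Im := normr_ge0 z; case: `|z| => a b /= ->. Qed.

Lemma cabs_ge0 z : 0 <= cabs z.
Proof. by rewrite -ler0c -normr_cabs normr_ge0. Qed.

Lemma cabsM z w : cabs (z * w) = cabs z * cabs w.
Proof. by apply: complexI; rewrite rmorphM -!normr_cabs normrM. Qed.

Lemma cabs0 : cabs 0 = 0. Proof. by rewrite /cabs normr0. Qed.
Lemma cabs1 : cabs 1 = 1. Proof. by rewrite /cabs normr1. Qed.
Lemma cabsN z : cabs (- z) = cabs z. Proof. by rewrite /cabs normrN. Qed.
Lemma cabs_distC z w : cabs (z - w) = cabs (w - z).
Proof. by rewrite /cabs distrC. Qed.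

Lemma cabsX z n : cabs (z ^+ n) = cabs z ^+ n.
Proof. by apply: complexI; rewrite rmorphXn -!normr_cabs normrX. Qed.

Lemma cabsV z : cabs z^-1 = (cabs z)^-1.
Proof. by apply: complexI; rewrite fmorphV -!normr_cabs normfV. Qed.

Lemma cabs_eq0 z : (cabs z == 0) = (z == 0).
Proof.
by rewrite -(inj_eq (@complexI R)) -normr_cabs (normr_eq0 z).
Qed.

Lemma cabs_gt0 z : (0 < cabs z) = (z != 0).
Proof. by rewrite lt0r cabs_eq0 cabs_ge0 andbT. Qed.

Lemma ler_cabsD z w : cabs (z + w) <= cabs z + cabs w.
Proof. by rewrite -lecR rmorphD -!normr_cabs ler_normD. Qed.

Lemma ler_cabsB z w : cabs (z - w) <= cabs z + cabs w.
Proof. by rewrite -(cabsN w) ler_cabsD. Qed.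

Lemma ler_cabs_dist z w : cabs z - cabs w <= cabs (z - w).
Proof. by rewrite lerBlDr -{1}(subrK w z) ler_cabsD. Qed.

Lemma cabs_real (x : R) : cabs (real_complex R x) = `|x|.
Proof. by rewrite /cabs normc_def /= expr0n addr0 sqrtr_sqr. Qed.

Lemma cabs_sum I (s : seq I) P (F : I -> C R) :
  cabs (\sum_(i <- s | P i) F i) <= \sum_(i <- s | P i) cabs (F i).
Proof.
elim/big_ind2: _ => [|x a y b xa yb|//]; first by rewrite cabs0.
by rewrite (le_trans (ler_cabsD _ _)) ?lerD.
Qed.

Lemma cabs_prod I (s : seq I) P (F : I -> C R) :
  cabs (\prod_(i <- s | P i) F i) = \prod_(i <- s | P i) cabs (F i).
Proof. exact: (big_morph _ cabsM cabs1). Qed.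

Lemma normr_Re_le z : `|complex.Re z| <= cabs z.
Proof.
rewrite /cabs normc_def /= -sqrtr_sqr ler_sqrt; last first.
  by rewrite addr_ge0 ?sqr_ge0.
by rewrite lerDl sqr_ge0.
Qed.

Lemma normr_Im_le z : `|complex.Im z| <= cabs z.
Proof.
rewrite /cabs normc_def /= -sqrtr_sqr ler_sqrt; last first.
  by rewrite addr_ge0 ?sqr_ge0.
by rewrite lerDr sqr_ge0.
Qed.

Lemma cabs_le_ReIm z : cabs z <= `|complex.Re z| + `|complex.Im z|.
Proof.
rewrite {1}(complexE z) (le_trans (ler_cabsD _ _))// cabsM !cabs_real.
by rewrite /cabs normc_def /= expr0n/= add0r expr1n sqrtr1 mul1r.
Qed.

Lemma cabs_sqr z : cabs z ^+ 2 = complex.Re z ^+ 2 + complex.Im z ^+ 2.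
Proof. by rewrite /cabs normc_def /= sqr_sqrtr// addr_ge0 ?sqr_ge0. Qed.

(** The derivative in little-o form: with neither quotient nor filter, explicit estimates apply
    directly and h = 0 is no exception. *)
Definition cder (u : C R -> C R) (t d : C R) : Prop :=
  forall e : R, 0 < e -> exists2 r : R, 0 < r &
    forall h, cabs h <= r -> cabs (u (t + h) - u t - d * h) <= e * cabs h.

Lemma cderP (u : C R -> C R) (t d : C R) : is_derive t (1 : C R) u d <-> cder u t d.
Proof.
split.
  move=> [ex <-] e e0.
  have : h^-1 *: (u (h *: 1 + t) - u t) @[h --> (0 : C R)^'] --> 'D_1 u t.
    exact: ex.
  move/cvgrPdist_le => /(_ (real_complex R e)); rewrite ltcR => /(_ e0).
  rewrite near_withinE => /nbhs_ballP[r /= r0 rP].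
  have [rr rE] : exists rr : R, r = real_complex R rr.
    by exists (complex.Re r); rewrite RRe_real// gtr0_real.
  exists (rr / 2) => [|h hr].
    by rewrite divr_gt0// -ltcR -rE.
  have rr0 : 0 < rr by rewrite -ltcR -rE.
  have [->|h0] := eqVneq h 0.
    by rewrite mulr0 addr0 !subrr cabs0 mulr0.
  have := rP h; rewrite /ball /= sub0r normrN normr_cabs rE ltcR => /(_ _ h0).
  rewrite normr_cabs lecR.
  have -> : 'D_1 u t - h^-1 *: (u (h *: 1 + t) - u t) =
     - ((u (t + h) - u t - 'D_1 u t * h) / h).
    by rewrite /GRing.scale /= mulr1 (addrC h t); field.
  rewrite cabsN cabsM cabsV ler_pdivrMr ?cabs_gt0//; apply.
  by rewrite (le_lt_trans hr)// ltr_pdivrMr// ltr_pMr ?ltr1n.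
move=> ud.
have lim_ : h^-1 *: (u (h *: 1 + t) - u t) @[h --> (0 : C R)^'] --> d.
  apply/cvgrPdist_le => e e0.
  have eE : e = real_complex R (complex.Re e) by rewrite RRe_real// gtr0_real.
  have e0' : 0 < complex.Re e by rewrite -ltcR -eE.
  have [r r0 rP] := ud _ e0'.
  rewrite near_withinE; apply/nbhs_ballP; exists (real_complex R r) => /=.
    by rewrite ltcR.
  move=> h; rewrite /ball /= sub0r normrN normr_cabs ltcR => /ltW hr h0.
  rewrite normr_cabs eE lecR.
  have -> : d - h^-1 *: (u (h *: 1 + t) - u t) =
     - ((u (t + h) - u t - d * h) / h).
    by rewrite /GRing.scale /= mulr1 (addrC h t); field.
  by rewrite cabsN cabsM cabsV ler_pdivrMr ?cabs_gt0//; exact: rP.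
by split; [apply/cvg_ex; exists d | exact: cvg_lim].
Qed.

End Modulus.

Section Calculus.
Context {R : realType}.
Local Open Scope classical_set_scope.
Implicit Types (u v : C R -> C R) (t d z w : C R).

Lemma is_derive_real (f : R -> R) (x d : R) :
  (forall e : R, 0 < e -> exists2 r : R, 0 < r &
    forall h, `|h| <= r -> `|f (x + h) - f x - d * h| <= e * `|h|) ->
  is_derive x 1 f d.
Proof.
move=> fd.
have lim_ : h^-1 *: (f (h *: 1 + x) - f x) @[h --> (0 : R)^'] --> d.
  apply/cvgrPdist_le => e e0; have [r r0 rP] := fd _ e0.
  rewrite near_withinE; apply/nbhs_ballP; exists r => //= h.
  rewrite /ball /= sub0r normrN => /ltW hr h0.
  have -> : d - h^-1 *: (f (h *: 1 + x) - f x) =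
     - ((f (x + h) - f x - d * h) / h).
    by rewrite /GRing.scale /= mulr1 (addrC h x); field.
  by rewrite normrN normrM normfV ler_pdivrMr ?normr_gt0//; exact: rP.
by split; [apply/cvg_ex; exists d | exact: cvg_lim].
Qed.

Lemma cder_uniq u t d d' : cder u t d -> cder u t d' -> d = d'.
Proof. by move=> /cderP[_ <-] /cderP[_ <-]. Qed.

Lemma cder_eq u v t d d' : u =1 v -> d = d' -> cder u t d -> cder v t d'.
Proof. by move=> uv <- ud e e0; have [r r0 rP] := ud e e0; exists r => // h; rewrite -!uv; exact: rP. Qed.

Lemma cder_cst d t : cder (fun=> d) t 0.
Proof. by apply/cderP; exact: is_derive_cst. Qed.

Lemma cder_id t : cder id t 1.
Proof. by apply/cderP; exact: is_derive_id. Qed.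

Lemma cderD u v t d d' : cder u t d -> cder v t d' ->
  cder (fun s => u s + v s) t (d + d').
Proof. by move=> /cderP ? /cderP ?; apply/cderP; exact: is_deriveD. Qed.

Lemma cderB u v t d d' : cder u t d -> cder v t d' ->
  cder (fun s => u s - v s) t (d - d').
Proof. by move=> /cderP ? /cderP ?; apply/cderP; exact: is_deriveB. Qed.

Lemma cderM u v t d d' : cder u t d -> cder v t d' ->
  cder (fun s => u s * v s) t (u t * d' + v t * d).
Proof. by move=> /cderP ? /cderP ?; apply/cderP; exact: is_deriveM. Qed.

Lemma cderZ c u t d : cder u t d -> cder (fun s => c * u s) t (c * d).
Proof.
move=> ud; have := cderM (cder_cst c t) ud.
by rewrite mulr0 addr0.
Qed.

Lemma cderX n u t d : cder u t d ->
  cder (fun s => u s ^+ n) t (n%:R * u t ^+ n.-1 * d).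
Proof.
move=> ud; elim: n => [|n IH]; first by rewrite !mul0r; exact: cder_cst.
under eq_fun do rewrite exprS.
apply: eq_ind (cderM ud IH) _ _.
case: n {IH} => [|n] /=; first by ring.
by rewrite -[n.+2%:R]natr1 [u t ^+ n.+1]exprS; ring.
Qed.

Lemma cder_lip u t d : cder u t d -> exists2 r : R, 0 < r &
  forall h, cabs h <= r -> cabs (u (t + h) - u t) <= (cabs d + 1) * cabs h.
Proof.
move=> ud; have [r r0 rP] := ud 1 ltr01; exists r => // h hr.
rewrite -(subrK (d * h) (u _ - _)) (le_trans (ler_cabsD _ _))// cabsM addrC mulrDl.
by rewrite lerD2l rP.
Qed.

Lemma cder_continuous u t d : cder u t d -> forall e : R, 0 < e ->
  exists2 r : R, 0 < r & forall h, cabs h <= r -> cabs (u (t + h) - u t) <= e.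
Proof.
move=> /cder_lip[r r0 rP] e e0.
have d0 : 0 < cabs d + 1 by rewrite ltr_wpDl ?cabs_ge0.
exists (Num.min r (e / (cabs d + 1))) => [|h].
  by rewrite lt_min r0 divr_gt0.
rewrite le_min => /andP[hr he]; rewrite (le_trans (rP _ hr))//.
by rewrite mulrC -ler_pdivlMr.
Qed.

Lemma cder_comp u v t d d' : cder v t d' -> cder u (v t) d ->
  cder (fun s => u (v s)) t (d * d').
Proof.
move=> vd ud e e0.
have [r1 r10 r1P] := cder_lip vd.
have d0 : 0 < cabs d' + 1 by rewrite ltr_wpDl ?cabs_ge0.
have d1 : 0 < cabs d + 1 by rewrite ltr_wpDl ?cabs_ge0.
have [r2 r20 r2P] := ud (e / 2 / (cabs d' + 1)) ltac:(by rewrite !divr_gt0).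
have [r3 r30 r3P] := vd (e / 2 / (cabs d + 1)) ltac:(by rewrite !divr_gt0).
exists (Num.min r1 (Num.min (r2 / (cabs d' + 1)) r3)) => [|h].
  by rewrite !lt_min r10 divr_gt0.
rewrite !le_min => /and3P[h1 h2 h3].
set k := v (t + h) - v t.
have kE : v (t + h) = v t + k by rewrite /k [RHS]addrC subrK.
have kh : cabs k <= (cabs d' + 1) * cabs h by exact: r1P.
have kr : cabs k <= r2 by rewrite (le_trans kh)// mulrC -ler_pdivlMr.
rewrite kE (_ : _ - _ - _ = (u (v t + k) - u (v t) - d * k) + d * (k - d' * h)); last by ring.
rewrite (le_trans (ler_cabsD _ _))// cabsM [e]splitr mulrDl lerD//.
  rewrite (le_trans (r2P _ kr))// (le_trans (ler_wpM2l _ kh))//.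
    by rewrite !divr_ge0// ltW.
  by rewrite mulrA divfK// gt_eqF.
rewrite (@le_trans _ _ ((cabs d + 1) * cabs (k - d' * h)))//.
  by rewrite ler_wpM2r ?cabs_ge0// lerDl.
rewrite (le_trans (ler_wpM2l (ltW d1) (r3P _ h3)))//.
by rewrite mulrA [_ * (_ / _)]mulrC divfK// gt_eqF.
Qed.

Lemma cder_affine a b t : cder (fun s => a + s * b) t b.
Proof.
have := cderD (cder_cst a t) (cderM (cder_id t) (cder_cst b t)).
by rewrite mulr0 add0r add0r mulr1.
Qed.

(** The mean value theorem fails for complex values. It is applied to the real function s -> Re
    (conj D * u (p + s (q - p))) with D = u q - u p, whose increment over [0, 1] is |D|^2. *)
Lemma mean_value_bound u (p q : C R) (M : R) :
  (forall s : R, 0 <= s <= 1 ->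
    exists2 d, cder u (p + real_complex R s * (q - p)) d & cabs d <= M) ->
  cabs (u q - u p) <= M * cabs (q - p).
Proof.
move=> uM.
pose D := u q - u p.
pose F (s : R) := complex.Re (D^*%C * u (p + real_complex R s * (q - p))).
(* A choice of derivative on the segment; the default 0 outside [0, 1] is never consulted. *)
pose P (s : R) := if (0 <= s <= 1) =P true is ReflectT H then
   projT1 (cid2 (uM s H)) else 0.
have PE (s : R) : 0 <= s <= 1 -> cder u (p + real_complex R s * (q - p)) (P s) /\ cabs (P s) <= M.
  by rewrite /P; case: eqP => // H _; case: cid2.
have ReM (a : C R) : complex.Re a <= cabs a.
  exact: le_trans (ler_norm _) (normr_Re_le a).
have FD (s : R) : 0 <= s <= 1 -> is_derive s 1 F (complex.Re (D^*%C * (P s * (q - p)))).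
  move=> s01; have [Pd _] := PE s s01.
  have := cder_comp (cder_affine p (q - p) (real_complex R s)) Pd.
  move=> /(cderZ D^*%C) dd.
  apply: is_derive_real => e e0; have [r r0 rP] := dd _ e0.
  exists r => // h hr; have := rP (real_complex R h).
  rewrite cabs_real => /(_ hr) rh.
  apply: le_trans rh.
  apply: le_trans (normr_Re_le _).
  rewrite /F -rmorphD /=.
  rewrite !raddfB /=.
  have -> // : forall a : C R, complex.Re (a * real_complex R h) = complex.Re a * h.
  by move=> [x y] /=; rewrite mulr0 subr0.
have [c /andP[c0 c1] cE] : exists2 c, (0 < c < 1) & F 1 - F 0 = complex.Re (D^*%C * (P c * (q - p))).
  have F1 : forall x : R, x \in `]0, 1[%R ->
      is_derive x 1 F (complex.Re (D^*%C * (P x * (q - p)))).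
    by move=> x; rewrite in_itv /= => /andP[? ?]; apply: FD; rewrite !ltW.
  have F2 : {within `[0, 1]%classic, continuous F}.
    apply: derivable_within_continuous => s; rewrite in_itv /= => s01.
    by have [] := FD s s01.
  have [x] := MVT ltr01 F1 F2.
  by rewrite in_itv /= subr0 mulr1; exists x.
have DD : cabs D ^+ 2 = F 1 - F 0.
  rewrite /F -raddfB /= -mulrBr rmorph1 rmorph0 mul1r mul0r addr0 (addrC p) subrK -/D.
  by rewrite cabs_sqr; case: (D) => x y /=; ring.
have [_ PM] := PE c ltac:(by rewrite !ltW).
have [D0|D0] := eqVneq D 0.
  by rewrite -/D D0 cabs0 mulr_ge0 ?cabs_ge0// (le_trans (cabs_ge0 _) PM).
rewrite -/D -(ler_pM2l (x := cabs D)) ?cabs_gt0// -expr2 DD cE.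
rewrite (le_trans (ReM _))// !cabsM.
have -> : cabs D^*%C = cabs D by rewrite /cabs !normc_def /=; case: (D) => x y /=; rewrite sqrrN.
by rewrite ler_wpM2l ?cabs_ge0// ler_wpM2r ?cabs_ge0.
Qed.

End Calculus.

(** * The complex exponential *)

Section Cexp.
Context {R : realType}.
Implicit Types (z w t : C R) (x y : R).

Lemma cexpD z w : cexp (z + w) = cexp z * cexp w.
Proof.
case: z w => [a b] [c d]; rewrite /cexp /= expRD cosD sinD.
by apply/eqP; rewrite eq_complex /=; apply/andP; split; apply/eqP; ring.
Qed.

Lemma cexp0 : cexp 0 = 1 :> C R.
Proof. by rewrite /cexp /= expR0 cos0 sin0 mulr0 mulr1. Qed.

Lemma cexp_neq0 z : cexp z != 0.
Proof.
apply/eqP => z0; have := cexpD z (- z).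
by rewrite subrr cexp0 z0 mul0r => /eqP; rewrite oner_eq0.
Qed.

Lemma cexpN z : cexp (- z) = (cexp z)^-1.
Proof.
apply: (mulfI (cexp_neq0 z)); rewrite -cexpD subrr cexp0 mulfV//.
exact: cexp_neq0.
Qed.

Lemma cexpX z n : cexp z ^+ n = cexp (n%:R * z).
Proof.
elim: n => [|n IH]; first by rewrite mul0r cexp0.
by rewrite exprS IH -cexpD -[n.+1]add1n natrD mulrDl mul1r.
Qed.

Lemma cabs_cexp z : cabs (cexp z) = expR (complex.Re z).
Proof.
rewrite /cabs normc_def /= !exprMn -mulrDr cos2Dsin2 mulr1 sqrtr_sqr.
by rewrite ger0_norm// expR_ge0.
Qed.

Lemma cexp_real x : cexp (real_complex R x) = real_complex R (expR x).
Proof. by rewrite /cexp /= cos0 sin0 mulr0 mulr1. Qed.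

Lemma cexp_2pi z : cexp (z + Complex 0 (pi *+ 2)) = cexp z.
Proof.
by rewrite cexpD {2}/cexp /= cos2pi sin2pi expR0 mulr0 mulr1 mulr1.
Qed.

Lemma derive_eps (f : R -> R) x d : is_derive x 1 f d ->
  forall e : R, 0 < e -> exists2 r : R, 0 < r &
    forall h, `|h| <= r -> `|f (x + h) - f x - d * h| <= e * `|h|.
Proof.
move=> [ex <-] e e0.
have : (h^-1 *: (f (h *: 1 + x) - f x) @[h --> (0 : R)^'] --> 'D_1 f x)%classic.
  exact: ex.
move/cvgrPdist_le => /(_ e e0); rewrite near_withinE => /nbhs_ballP[r /= r0 rP].
exists (r / 2) => [|h hr]; first by rewrite divr_gt0.
have [->|h0] := eqVneq h 0.
  by rewrite mulr0 addr0 !subrr normr0 mulr0.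
have := rP h; rewrite /ball /= sub0r normrN => /(_ _ h0).
have -> : 'D_1 f x - h^-1 *: (f (h *: 1 + x) - f x) =
   - ((f (x + h) - f x - 'D_1 f x * h) / h).
  by rewrite /GRing.scale /= mulr1 (addrC h x); field.
rewrite normrN normrM normfV ler_pdivrMr ?normr_gt0//; apply.
by rewrite (le_lt_trans hr)// ltr_pdivrMr// ltr_pMr ?ltr1n.
Qed.

Lemma cder_cexp0 : cder (@cexp R) 0 1.
Proof.
move=> e e0.
(* Nine shares of e: six for the remainders of cosine and sine, multiplied by expR x <= 3; one for
   the remainder of expR; two for the cross term y * (expR x - 1). *)
have e9 : 0 < e / 9 by rewrite divr_gt0.
have [r1 r10 r1P] := derive_eps (is_derive_expR (0 : R)) e9.
have [r2 r20 r2P] := derive_eps (is_derive_cos (0 : R)) e9.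
have [r3 r30 r3P] := derive_eps (is_derive_sin (0 : R)) e9.
have [r4 r40 r4P] := derive_eps (is_derive_expR (0 : R)) ltr01.
exists (Num.min (Num.min r1 r2) (Num.min r3 (Num.min r4 (Num.min 1 (e / 9))))) => [|[x y]].
  by rewrite !lt_min r10 r20 r30 r40 ltr01.
set h := Complex x y; rewrite !le_min => /andP[/andP[h1 h2] /and4P[h3 h4 h5 h6]].
have xh : `|x| <= cabs h by exact: (normr_Re_le h).
have yh : `|y| <= cabs h by exact: (normr_Im_le h).
have := r1P x (le_trans xh h1); have := r2P y (le_trans yh h2).
have := r3P y (le_trans yh h3); have := r4P x (le_trans xh h4).
rewrite !add0r expR0 sin0 cos0 subr0 oppr0 !mul0r !subr0 !mul1r => E4 E3 E2 E1.
rewrite cexp0.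
set A := expR x - 1 - x in E1 E4; set B := cos y - 1 in E2; set S := sin y - y in E3.
have -> : cexp h - 1 - h = real_complex R (expR x) * (Complex B S) +
    real_complex R A + Complex 0 (y * (expR x - 1)).
  by rewrite /cexp /=; apply/eqP; rewrite eq_complex /= /A /B /S; apply/andP; split; apply/eqP; ring.
have ex : `|expR x - 1| <= 2 * cabs h.
  rewrite (_ : expR x - 1 = A + x); last by rewrite /A; ring.
  by rewrite (le_trans (ler_normD _ _))// mulr_natl mulr2n lerD// (le_trans E4).
have ex3 : expR x <= 3.
  rewrite -(subrK 1 (expR x)) (_ : 3 = 2 + 1) ?lerD2r; last by ring.
  by rewrite (le_trans (ler_norm _))// (le_trans ex)// -[leRHS]mulr1 ler_wpM2l.
have h0 := cabs_ge0 h.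
rewrite (le_trans (ler_cabsD _ _))// (_ : e * cabs h =
  (3 * (e / 9 * cabs h + e / 9 * cabs h) + e / 9 * cabs h) + (2 * (e / 9 * cabs h))); last by field.
apply: lerD.
  rewrite (le_trans (ler_cabsD _ _))// lerD//.
    rewrite cabsM cabs_real ger0_norm ?expR_ge0// ler_pM ?expR_ge0 ?cabs_ge0//.
    rewrite (le_trans (cabs_le_ReIm _))//= lerD//.
      by rewrite (le_trans E2)// ler_wpM2l// ltW.
    by rewrite (le_trans E3)// ler_wpM2l// ltW.
  by rewrite cabs_real (le_trans E1)// ler_wpM2l// ltW.
rewrite (le_trans (cabs_le_ReIm _))//= normr0 add0r normrM.
rewrite (le_trans (ler_pM _ _ (le_trans yh h6) ex))// mulrCA.
by rewrite lexx.
Qed.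

Lemma cder_cexp t : cder (@cexp R) t (cexp t).
Proof.
have := cderZ (cexp t) cder_cexp0; rewrite mulr1 => H e e0.
have [r r0 rP] := H e e0; exists r => // h hr.
by have := rP h hr; rewrite add0r cexp0 mulr1 cexpD.
Qed.

End Cexp.

(** * Goursat's lemma and Cauchy's formula *)

Section Integral.
Context {R : realType}.
Implicit Types (f g : R -> R) (u v : R -> C R) (a b x y : R) (c : C R).
Local Open Scope classical_set_scope.

Let mu := @lebesgue_measure R.

Lemma continuous_itv_integrable f a b : continuous f ->
  mu.-integrable `[a, b] (EFin \o f).
Proof.
move=> fc; apply: continuous_compact_integrable; first exact: segment_compact.
exact: continuous_subspaceT.
Qed.

Definition rint a b f : R := \int[mu]_(x in `[a, b]) f x.

Lemma rintD a b f g : continuous f -> continuous g ->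
  rint a b (fun x => f x + g x) = rint a b f + rint a b g.
Proof. by move=> fc gc; apply: RintegralD => //; exact: continuous_itv_integrable. Qed.

Lemma rintZ a b f x : continuous f ->
  rint a b (fun y => x * f y) = x * rint a b f.
Proof. by move=> fc; apply: RintegralZl => //; exact: continuous_itv_integrable. Qed.

Lemma rint_cst a b x : a <= b -> rint a b (fun=> x) = x * (b - a).
Proof.
move=> ab; rewrite /rint Rintegral_cst//= lebesgue_measure_itv /= lte_fin.
by move: ab; rewrite le_eqVlt => /predU1P[->|->]; rewrite ?ltxx /= ?subrr.
Qed.

Lemma rint_split a b x f : continuous f -> a <= x <= b ->
  rint a b f = rint a x f + rint x b f.
Proof.
move=> fc /andP[ax xb]; apply/eqP; rewrite addrC -subr_eq; apply/eqP.
rewrite /rint Rintegral_itvB ?bnd_simp//; last exact: continuous_itv_integrable.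
rewrite Rintegral_itv_obnd_cbnd//.
apply: integrableS (continuous_itv_integrable x b fc) => //.
by apply: subset_itvr; rewrite bnd_simp.
Qed.

Lemma rint_bound a b f x : continuous f -> a <= b ->
  (forall y, a <= y <= b -> `|f y| <= x) -> `|rint a b f| <= x * (b - a).
Proof.
move=> fc ab fx; rewrite (le_trans (le_normr_Rintegral _ _))//=.
  exact: continuous_itv_integrable.
rewrite -rint_cst//; apply: le_Rintegral => //.
- have : continuous (fun y => `|f y|).
    by move=> y; apply: continuous_comp; [exact: fc|exact: norm_continuous].
  exact: continuous_itv_integrable.
- by apply: continuous_itv_integrable; exact: cst_continuous.
Qed.

Definition rcont u := forall x e, 0 < e -> exists2 r : R, 0 < r &
  forall h, `|h| <= r -> cabs (u (x + h) - u x) <= e.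

Lemma rcont_part (P : C R -> R) u :
  (forall z w, P (z - w) = P z - P w) -> (forall z, `|P z| <= cabs z) ->
  rcont u -> continuous (P \o u).
Proof.
move=> PB Pn uc x; apply/cvgrPdist_le => e e0.
have [r r0 rP] := uc x e e0; apply/nbhs_ballP; exists r => //= y.
rewrite /ball /= => /ltW xy.
rewrite /= -PB (le_trans (Pn _))// cabs_distC (_ : y = x + (y - x)); last by ring.
by apply: rP; rewrite distrC.
Qed.

Lemma rcont_Re u : rcont u -> continuous (fun x => complex.Re (u x)).
Proof. by apply: rcont_part => [z w|]; [rewrite raddfB|exact: normr_Re_le]. Qed.

Lemma rcont_Im u : rcont u -> continuous (fun x => complex.Im (u x)).
Proof. by apply: rcont_part => [z w|]; [rewrite raddfB|exact: normr_Im_le]. Qed.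

Lemma rcontD u v : rcont u -> rcont v -> rcont (fun x => u x + v x).
Proof.
move=> uc vc x e e0.
have e2 : 0 < e / 2 by rewrite divr_gt0.
have [r r0 rP] := uc x _ e2; have [s s0 sP] := vc x _ e2.
exists (Num.min r s) => [|h]; first by rewrite lt_min r0.
rewrite le_min => /andP[hr hs].
rewrite (_ : _ - _ = (u (x + h) - u x) + (v (x + h) - v x)); last by ring.
by rewrite (le_trans (ler_cabsD _ _))// [e]splitr lerD ?rP ?sP.
Qed.

Lemma rcontZ c u : rcont u -> rcont (fun x => c * u x).
Proof.
move=> uc x e e0.
have c0 : 0 < cabs c + 1 by rewrite ltr_wpDl ?cabs_ge0.
have [r r0 rP] := uc x (e / (cabs c + 1)) (divr_gt0 e0 c0).
exists r => // h hr; rewrite -mulrBr cabsM.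
rewrite (le_trans (ler_wpM2l (cabs_ge0 _) (rP h hr)))//.
by rewrite mulrCA ler_piMr ?(ltW e0)// ler_pdivrMr// mul1r lerDl.
Qed.

Lemma rcont_cst c : rcont (fun=> c).
Proof. by move=> x e e0; exists 1 => // h _; rewrite subrr cabs0 ltW. Qed.

Definition cint a b u : C R :=
  Complex (rint a b (fun x => complex.Re (u x)))
          (rint a b (fun x => complex.Im (u x))).

Lemma cintD a b u v : rcont u -> rcont v ->
  cint a b (fun x => u x + v x) = cint a b u + cint a b v.
Proof.
move=> uc vc; apply/eqP; rewrite eq_complex /= -!rintD; last 4 first.
- exact: rcont_Im.
- exact: rcont_Im.
- exact: rcont_Re.
- exact: rcont_Re.
by apply/andP; split; apply/eqP; congr rint; apply/funext => x; rewrite raddfD.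
Qed.

Lemma cintZ a b c u : rcont u -> cint a b (fun x => c * u x) = c * cint a b u.
Proof.
move=> uc; have Rc := rcont_Re uc; have Ic := rcont_Im uc.
have Zc (k : R) f : continuous f -> continuous (fun x => k * f x).
  by move=> fc x; apply: continuousM; [exact: cst_continuous|exact: fc].
apply/eqP; rewrite eq_complex; apply/andP; split; apply/eqP; case: c => p q /=.
  rewrite -mulNr -!rintZ// -rintD; [|exact: Zc..].
  by congr rint; apply/funext => x; case: (u x) => s t /=; ring.
rewrite -!rintZ// -rintD; [|exact: Zc..].
by congr rint; apply/funext => x; case: (u x) => s t /=; ring.
Qed.

Lemma cintB a b u v : rcont u -> rcont v ->
  cint a b (fun x => u x - v x) = cint a b u - cint a b v.
Proof.
move=> uc vc; rewrite -[- cint a b v]mulN1r -cintZ// -cintD//; last exact: rcontZ.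
by congr cint; apply/funext => x; rewrite mulN1r.
Qed.

Lemma cint_cst a b c : a <= b -> cint a b (fun=> c) = c * real_complex R (b - a).
Proof.
move=> ab; rewrite /cint !rint_cst//.
by apply/eqP; rewrite eq_complex; apply/andP; split; apply/eqP; case: c => p q /=; ring.
Qed.

Lemma cint_split a b x u : rcont u -> a <= x <= b ->
  cint a b u = cint a x u + cint x b u.
Proof.
move=> uc axb; rewrite /cint (rint_split (rcont_Re uc) axb).
by rewrite (rint_split (rcont_Im uc) axb).
Qed.

(** Real and imaginary parts are bounded separately, whence the factor 2, which persists in Cauchy's
    estimates; only some absolute constant matters there. *)
Lemma cint_bound a b u M : rcont u -> a <= b ->
  (forall y, a <= y <= b -> cabs (u y) <= M) ->
  cabs (cint a b u) <= 2 * M * (b - a).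
Proof.
move=> uc ab uM; rewrite (le_trans (cabs_le_ReIm _))//= -mulrA mulr_natl mulr2n lerD//.
  apply: rint_bound => //; first exact: rcont_Re.
  by move=> y /uM; apply: le_trans; exact: normr_Re_le.
apply: rint_bound => //; first exact: rcont_Im.
by move=> y /uM; apply: le_trans; exact: normr_Im_le.
Qed.

End Integral.

Section ImaginaryUnit.
Context {R : realType}.

Definition imunit : C R := Complex 0 1.

Lemma cabs_imag (x : R) : cabs (Complex 0 x) = `|x|.
Proof. by rewrite /cabs normc_def /= expr0n add0r sqrtr_sqr. Qed.

Lemma cabs_imunit : cabs imunit = 1.
Proof. by rewrite cabs_imag normr1. Qed.

Lemma imunit_neq0 : imunit != 0.
Proof. by rewrite -cabs_gt0 cabs_imunit. Qed.

Lemma imag_imunit (x : R) : Complex 0 x = imunit * real_complex R x.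
Proof. by apply/eqP; rewrite eq_complex /=; apply/andP; split; apply/eqP; ring. Qed.

End ImaginaryUnit.

(** * Goursat's theorem on rectangles *)

Section Goursat.
Context {R : realType}.
Variable (g : C R -> C R) (g' : C R -> C R).
Hypothesis gd : forall w, cder g w (g' w).
Implicit Types (a b x y : R).

Lemma rcont_horizontal y : rcont (fun x => g (Complex x y)).
Proof.
move=> x e e0; have [r r0 rP] := cder_continuous (gd (Complex x y)) e0.
exists r => // h hr.
have -> : Complex (x + h) y = Complex x y + real_complex R h.
  by apply/eqP; rewrite eq_complex /= addr0 !eqxx.
by apply: rP; rewrite cabs_real.
Qed.

Lemma rcont_vertical x : rcont (fun y => g (Complex x y)).
Proof.
move=> y e e0; have [r r0 rP] := cder_continuous (gd (Complex x y)) e0.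
exists r => // h hr.
have -> : Complex x (y + h) = Complex x y + Complex 0 h.
  by apply/eqP; rewrite eq_complex /= addr0 !eqxx.
by apply: rP; rewrite cabs_imag.
Qed.

(* The sides are paired, so that constants and linear functions integrate to
   zero by [cint_cst] alone. *)
Definition bdint (x0 x1 y0 y1 : R) : C R :=
  cint x0 x1 (fun x => g (Complex x y0) - g (Complex x y1)) +
  imunit * cint y0 y1 (fun y => g (Complex x1 y) - g (Complex x0 y)).

Lemma bdintE x0 x1 y0 y1 : bdint x0 x1 y0 y1 =
  cint x0 x1 (fun x => g (Complex x y0)) - cint x0 x1 (fun x => g (Complex x y1)) +
  imunit * (cint y0 y1 (fun y => g (Complex x1 y)) -
                 cint y0 y1 (fun y => g (Complex x0 y))).
Proof.
by rewrite /bdint !cintB//; [exact: rcont_vertical..|exact: rcont_horizontal |exact: rcont_horizontal].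
Qed.

Lemma bdint_quarter x0 x x1 y0 y y1 : x0 <= x <= x1 -> y0 <= y <= y1 ->
  bdint x0 x1 y0 y1 = bdint x0 x y0 y + bdint x x1 y0 y +
                      (bdint x0 x y y1 + bdint x x1 y y1).
Proof.
move=> xP yP; rewrite !bdintE.
rewrite (cint_split (rcont_horizontal y0) xP) (cint_split (rcont_horizontal y1) xP).
rewrite (cint_split (rcont_vertical x0) yP) (cint_split (rcont_vertical x1) yP).
ring.
Qed.

Lemma bdint_local w (e : R) : 0 < e -> exists2 r : R, 0 < r &
  forall x0 x1 y0 y1, x0 <= complex.Re w <= x1 -> y0 <= complex.Im w <= y1 ->
    (x1 - x0) + (y1 - y0) <= r ->
    cabs (bdint x0 x1 y0 y1) <= 4 * e * ((x1 - x0) + (y1 - y0)) ^+ 2.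
Proof.
move=> e0; have [r r0 rP] := gd w e0; exists r => // x0 x1 y0 y1.
move=> /andP[x0w wx1] /andP[y0w wy1] sr.
set s := (x1 - x0) + (y1 - y0) in sr *.
have x01 := le_trans x0w wx1; have y01 := le_trans y0w wy1.
pose rem z := g z - g w - g' w * (z - w).
have remP x y : x0 <= x <= x1 -> y0 <= y <= y1 -> cabs (rem (Complex x y)) <= e * s.
  move=> /andP[xa xb] /andP[ya yb].
  have hs : cabs (Complex x y - w) <= s.
    rewrite (le_trans (cabs_le_ReIm _))// /s !raddfB /=.
    by rewrite lerD// ler_norml; apply/andP; split; lra.
  have := rP _ (le_trans hs sr); rewrite (addrC w) subrK => H.
  by rewrite (le_trans H)// ler_wpM2l// ltW.
pose A x := g (Complex x y0) - g (Complex x y1).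
pose B y := g (Complex x1 y) - g (Complex x0 y).
have Ac : rcont A.
  rewrite /A; under eq_fun do rewrite -mulN1r.
  by apply: rcontD; [|apply: rcontZ]; exact: rcont_horizontal.
have Bc : rcont B.
  rewrite /B; under eq_fun do rewrite -mulN1r.
  by apply: rcontD; [|apply: rcontZ]; exact: rcont_vertical.
(* On paired sides the affine part of g at w amounts to the constants - cA and - cB, and cA * (x1 -
   x0) + imunit * cB * (y1 - y0) = 0: only the remainders are left to integrate. *)
pose cA := g' w * Complex 0 (y1 - y0).
pose cB := - (g' w * real_complex R (x1 - x0)).
have AE x : A x + cA = rem (Complex x y0) - rem (Complex x y1).
  rewrite /A /cA /rem.
  have -> : Complex 0 (y1 - y0) = Complex x y1 - Complex x y0.
    by apply/eqP; rewrite eq_complex /= subrr !eqxx.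
  by ring.
have BE y : B y + cB = rem (Complex x1 y) - rem (Complex x0 y).
  rewrite /B /cB /rem.
  have -> : real_complex R (x1 - x0) = Complex x1 y - Complex x0 y.
    by apply/eqP; rewrite eq_complex /= subrr !eqxx.
  by ring.
have -> : bdint x0 x1 y0 y1 = cint x0 x1 (fun x => A x + cA) +
    imunit * cint y0 y1 (fun y => B y + cB).
  rewrite (cintD _ _ Ac (rcont_cst cA)) (cintD _ _ Bc (rcont_cst cB)).
  rewrite !cint_cst// /bdint -/A -/B /cA /cB.
  by rewrite imag_imunit; ring.
have es0 : 0 <= e * s by rewrite mulr_ge0 ?(ltW e0)// addr_ge0 ?subr_ge0.
rewrite (le_trans (ler_cabsD _ _))// cabsM cabs_imunit mul1r.
have -> : 4 * e * s ^+ 2 = 2 * (e * s + e * s) * (x1 - x0) + 2 * (e * s + e * s) * (y1 - y0).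
  by rewrite /s; ring.
apply: lerD; apply: cint_bound => //; try by apply: rcontD => //; exact: rcont_cst.
  move=> x xP; rewrite AE (le_trans (ler_cabsB _ _))// lerD//; apply: remP => //.
    by rewrite lexx.
  by rewrite lexx andbT.
move=> y yP; rewrite BE (le_trans (ler_cabsB _ _))// lerD//; apply: remP => //.
  by rewrite lexx andbT.
by rewrite lexx.
Qed.

Lemma nested_intervals (l r : nat -> R) : (forall n, l n <= l n.+1) ->
  (forall n, r n.+1 <= r n) -> (forall n, l n <= r n) ->
  exists x, forall n, l n <= x <= r n.
Proof.
move=> lI rD lr.
have lm n m : l n <= l (n + m)%N.
  by elim: m => [|m IH]; rewrite ?addn0 ?lexx// addnS (le_trans IH).
have rm n m : r (n + m)%N <= r n.
  by elim: m => [|m IH]; rewrite ?addn0 ?lexx// addnS (le_trans _ IH).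
have lrnm n m : l n <= r m.
  by rewrite (le_trans (lm n m))// (le_trans (lr _))// addnC rm.
pose E : set R := range l; exists (sup E) => n.
have ubE m : ubound E (r m) by move=> _ [k _ <-]; exact: lrnm.
apply/andP; split.
  by apply: ub_le_sup; [exists (r 0%N); exact: ubE|exists n].
by apply: ge_sup; [exists (l 0%N); exists 0%N|exact: ubE].
Qed.

Lemma exists_expn2_gt (x : R) : exists n : nat, x < 2 ^+ n.
Proof.
exists (Num.bound `|x|); apply: (le_lt_trans (ler_norm x)).
apply: (@lt_trans _ _ (Num.bound `|x|)%:R); last first.
  by rewrite -natrX ltr_nat ltn_expl.
exact: archi_boundP (normr_ge0 _).
Qed.

Theorem goursat x0 x1 y0 y1 : x0 <= x1 -> y0 <= y1 -> bdint x0 x1 y0 y1 = 0.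
Proof.
move=> x01 y01; apply/eqP; apply: contraT => J0.
pose rect := ((R * R) * (R * R))%type.
pose J (Q : rect) := cabs (bdint Q.1.1 Q.1.2 Q.2.1 Q.2.2).
pose ok (Q : rect) := (Q.1.1 <= Q.1.2) && (Q.2.1 <= Q.2.2).
pose sz (Q : rect) := (Q.1.2 - Q.1.1) + (Q.2.2 - Q.2.1).
pose inn (Q Q' : rect) := [&& Q.1.1 <= Q'.1.1, Q'.1.2 <= Q.1.2,
   Q.2.1 <= Q'.2.1 & Q'.2.2 <= Q.2.2].
(* [ok Q] stands under the existential so that [choice] yields a total map; on an improper rectangle
   Q itself is a dummy answer. *)
have step (Q : rect) : exists Q', ok Q ->
    [/\ ok Q', inn Q Q', sz Q' = sz Q / 2 & J Q <= 4 * J Q'].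
  case: (boolP (ok Q)) => [|_]; last by exists Q.
  case: Q => [[a b] [c d]] /andP[/= ab cd].
  pose m := (a + b) / 2; pose n := (c + d) / 2.
  have amb : a <= m <= b by rewrite /m; apply/andP; split; lra.
  have cnd : c <= n <= d by rewrite /n; apply/andP; split; lra.
  pose Q1 : rect := ((a, m), (c, n)); pose Q2 : rect := ((m, b), (c, n)).
  pose Q3 : rect := ((a, m), (n, d)); pose Q4 : rect := ((m, b), (n, d)).
  have JQ : J ((a, b), (c, d)) <= J Q1 + J Q2 + (J Q3 + J Q4).
    rewrite {1}/J /= (bdint_quarter amb cnd) (le_trans (ler_cabsD _ _))//.
    by rewrite lerD// ler_cabsD.
  case/andP: amb => am mb; case/andP: cnd => cn nd.
  have [H|H1] := lerP (J ((a, b), (c, d))) (4 * J Q1).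
    exists Q1 => _; split=> //; rewrite /ok /inn /sz /= ?lexx ?am ?cn ?mb ?nd//.
    by rewrite /m /n; field.
  have [H|H2] := lerP (J ((a, b), (c, d))) (4 * J Q2).
    exists Q2 => _; split=> //; rewrite /ok /inn /sz /= ?lexx ?am ?cn ?mb ?nd//.
    by rewrite /m /n; field.
  have [H|H3] := lerP (J ((a, b), (c, d))) (4 * J Q3).
    exists Q3 => _; split=> //; rewrite /ok /inn /sz /= ?lexx ?am ?cn ?mb ?nd//.
    by rewrite /m /n; field.
  exists Q4 => _; split; rewrite /ok /inn /sz /= ?lexx ?am ?cn ?mb ?nd//.
    by rewrite /m /n; field.
  move: JQ H1 H2 H3.
  by move: (J Q1) (J Q2) (J Q3) (J Q4) (J _) => j1 j2 j3 j4 j; clear; lra.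
have [F FP] := choice step.
pose Q n := iter n F ((x0, x1), (y0, y1)).
have okQ n : ok (Q n).
  elim: n => [|n IH] /=; first by rewrite /ok /= x01.
  by have [] := FP _ IH.
have innQ n : inn (Q n) (Q n.+1) by have [] := FP _ (okQ n).
have szQ n : sz (Q n) = sz (Q 0%N) / 2 ^+ n.
  elim: n => [|n IH]; first by rewrite expr0 divr1.
  have [_ _ /= -> _] := FP _ (okQ n); rewrite IH exprSr.
  by field; rewrite expf_neq0// pnatr_eq0.
have JQ n : J (Q 0%N) <= 4 ^+ n * J (Q n).
  elim: n => [|n IH]; first by rewrite expr0 mul1r.
  have [_ _ _ H] := FP _ (okQ n); rewrite (le_trans IH)//.
  by rewrite exprSr -mulrA ler_wpM2l// exprn_ge0.
have [x xP] : exists x, forall n, (Q n).1.1 <= x <= (Q n).1.2.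
  apply: nested_intervals => n; [by case/and4P: (innQ n)|by case/and4P: (innQ n)|].
  by case/andP: (okQ n).
have [y yP] : exists y, forall n, (Q n).2.1 <= y <= (Q n).2.2.
  apply: nested_intervals => n; [by case/and4P: (innQ n)|by case/and4P: (innQ n)|].
  by case/andP: (okQ n).
have Jpos : 0 < J (Q 0%N) by rewrite /J /= cabs_gt0.
pose s := sz (Q 0%N).
have s0 : 0 <= s by case/andP: (okQ 0%N) => *; rewrite addr_ge0// subr_ge0.
(* At depth n, [bdint_local] gives J (Q n) <= 4 * e * s ^+ 2 / 4 ^+ n, whereas quartering gives J (Q
   0) <= 4 ^+ n * J (Q n). This e keeps 4 * e * s ^+ 2 below J (Q 0); the summand 1 covers s = 0. *)
pose e := J (Q 0%N) / (8 * (s ^+ 2 + 1)).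
have s21 : 0 < s ^+ 2 + 1 by rewrite ltr_wpDl// sqr_ge0.
have e0 : 0 < e by rewrite divr_gt0// mulr_gt0.
have [r r0 rP] := bdint_local (Complex x y) e0.
have [n nP] := exists_expn2_gt (s / r).
have szr : sz (Q n) <= r.
  rewrite szQ -/s ler_pdivrMr ?exprn_gt0// mulrC -ler_pdivrMr//; exact: ltW.
have := rP _ _ _ _ (xP n) (yP n) szr; rewrite -/(J _) -/(sz _) szQ -/s => H.
have := JQ n; rewrite leNgt => /negP; case.
apply: le_lt_trans (ler_wpM2l (exprn_ge0 n (ler0n R 4)) H) _.
rewrite expr_div_n -exprM mulnC exprM (_ : 2 ^+ 2 = 4 :> R); last by ring.
rewrite mulrCA [4 ^+ n * _]mulrC divfK ?expf_neq0 ?pnatr_eq0//.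
rewrite (_ : 4 * e * s ^+ 2 = J (Q 0%N) * (s ^+ 2 / (2 * (s ^+ 2 + 1)))); last first.
  by rewrite /e; field; rewrite gt_eqF//=.
rewrite gtr_pMr// ltr_pdivrMr ?mulr_gt0// mul1r.
have := sqr_ge0 s; lra.
Qed.

End Goursat.

(** * Cauchy's formula for the first derivative *)

Section CauchyIntegral.
Context {R : realType}.
Implicit Types (u v : C R -> C R) (z w t s : C R) (x y : R).

Definition twopi : R := pi *+ 2.

Lemma twopi_gt0 : 0 < twopi.
Proof. by rewrite mulrn_wgt0// pi_gt0. Qed.

(* The coefficient of order 1 of [v] on the circle of radius [expR x]. *)
Definition cauchyop x v : C R := (real_complex R twopi)^-1 *
  cint 0 twopi (fun y => v (cexp (Complex x y)) * cexp (- Complex x y)).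

Definition circ_cont x v := rcont (fun y => v (cexp (Complex x y))).

Lemma cder_cexpN w : cder (fun w => cexp (- w)) w (- cexp (- w)).
Proof.
apply: cder_eq (cder_comp (cderB (cder_cst 0 w) (cder_id w)) (cder_cexp (0 - w))).
  by move=> t; rewrite /= sub0r.
by rewrite !sub0r mulrN1.
Qed.

Lemma cder_circ_cont x u u' : (forall w, cder u w (u' w)) -> circ_cont x u.
Proof.
move=> ud.
exact: rcont_vertical (fun w => cder_comp (cder_cexp w) (ud (cexp w))) x.
Qed.

Lemma rcontM (f g : R -> C R) : rcont f -> rcont g -> rcont (fun y => f y * g y).
Proof.
move=> fc gc y e e0.
have f0 : 0 < cabs (f y) + 1 by rewrite ltr_wpDl ?cabs_ge0.
have g0 : 0 < cabs (g y) + 1 by rewrite ltr_wpDl ?cabs_ge0.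
have [r1 r10 r1P] := fc y 1 ltr01.
have [r2 r20 r2P] := fc y (e / 2 / (cabs (g y) + 1)) ltac:(by rewrite !divr_gt0).
have [r3 r30 r3P] := gc y (e / 2 / (cabs (f y) + 1)) ltac:(by rewrite !divr_gt0).
exists (Num.min r1 (Num.min r2 r3)) => [|h]; first by rewrite !lt_min r10 r20.
rewrite !le_min => /and3P[h1 h2 h3].
rewrite (_ : _ - _ = f (y + h) * (g (y + h) - g y) + (f (y + h) - f y) * g y); last by ring.
rewrite (le_trans (ler_cabsD _ _))// !cabsM [e]splitr lerD//.
  have fh : cabs (f (y + h)) <= cabs (f y) + 1.
    by rewrite -lerBlDl (le_trans (ler_cabs_dist _ _))// r1P.
  rewrite (le_trans (ler_pM (cabs_ge0 _) (cabs_ge0 _) fh (r3P _ h3)))//.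
  by rewrite mulrC divfK// gt_eqF.
rewrite (le_trans (ler_wpM2r (cabs_ge0 _) (r2P _ h2)))//.
rewrite -[leRHS](divfK (lt0r_neq0 g0)) ler_wpM2l//; last by rewrite lerDl.
by rewrite !divr_ge0// ltW.
Qed.

Lemma cauchyop_rcont x v : circ_cont x v ->
  rcont (fun y => v (cexp (Complex x y)) * cexp (- Complex x y)).
Proof.
move=> vc; apply: rcontM => //.
exact: rcont_vertical cder_cexpN x.
Qed.

Lemma cauchyopD x u v : circ_cont x u -> circ_cont x v ->
  cauchyop x (fun s => u s + v s) = cauchyop x u + cauchyop x v.
Proof.
move=> uc vc; rewrite /cauchyop -mulrDr -(cintD _ _ (cauchyop_rcont uc) (cauchyop_rcont vc)).
by congr (_ * cint _ _ _); apply/funext => y; rewrite mulrDl.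
Qed.

Lemma cauchyopZ x c u : circ_cont x u ->
  cauchyop x (fun s => c * u s) = c * cauchyop x u.
Proof.
move=> uc; rewrite /cauchyop mulrCA -(cintZ _ _ _ (cauchyop_rcont uc)).
by congr (_ * cint _ _ _); apply/funext => y; rewrite mulrA.
Qed.

Lemma cauchyop_bound x v M : circ_cont x v ->
  (forall s, cabs s = expR x -> cabs (v s) <= M) ->
  cabs (cauchyop x v) <= 2 * M * expR (- x).
Proof.
move=> vc vM; have tp := twopi_gt0.
rewrite /cauchyop cabsM cabsV cabs_real gtr0_norm// ler_pdivrMl//.
have := @cint_bound _ 0 twopi _ (M * expR (- x)) (cauchyop_rcont vc) (ltW tp).
rewrite subr0 => H; rewrite (le_trans (H _))//.
  by move=> y _; rewrite cabsM cabs_cexp /= ler_wpM2r ?expR_ge0// vM// cabs_cexp.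
by rewrite le_eqVlt; apply/orP; left; apply/eqP; ring.
Qed.

Section Invariance.
Variables (u u' : C R -> C R).
Hypothesis ud : forall w, cder u w (u' w).

(** The exponential carries a rectangle of height 2 pi onto the annulus between the two circles. The
    integrand u (cexp w) * cexp (- w) has period 2 pi i, so the horizontal sides cancel, and
    Goursat's theorem equates the vertical ones. *)
Lemma cauchyop_invariant x0 x1 : x0 <= x1 -> cauchyop x0 u = cauchyop x1 u.
Proof.
move=> x01; pose h w := u (cexp w) * cexp (- w).
have hd w := cderM (cder_comp (cder_cexp w) (ud (cexp w))) (cder_cexpN w).
have := goursat hd x01 (ltW twopi_gt0); rewrite (bdintE hd).
have -> : (fun x => h (Complex x twopi)) = (fun x => h (Complex x 0)).
  apply/funext => x; rewrite /h !cexpN.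
  have -> : Complex x twopi = Complex x 0 + Complex 0 (pi *+ 2).
    by apply/eqP; rewrite eq_complex /= addr0 add0r !eqxx.
  by rewrite cexp_2pi.
rewrite subrr add0r => /eqP; rewrite mulf_eq0 (negPf imunit_neq0) /=.
by rewrite subr_eq0 => /eqP E; rewrite /cauchyop -E.
Qed.

End Invariance.

(** No trigonometric integral is computed: for the constant 1, scaling multiplies the value k at
    radius 1 by expR (- 1) when the radius becomes expR 1, while invariance keeps it equal to k. *)
Lemma cauchyop_cst x c : cauchyop x (fun=> c) = 0.
Proof.
have -> : (fun=> c) = (fun s => c * (fun=> 1) s) by apply/funext => s; rewrite mulr1.
have c1 : forall y, circ_cont y (fun=> 1) by move=> y; exact: rcont_cst.
rewrite cauchyopZ//; suff -> : cauchyop x (fun=> 1) = 0 by rewrite mulr0.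
have E y : cauchyop y (fun=> 1) = cexp (real_complex R (- y)) * cauchyop 0 (fun=> 1).
  rewrite /cauchyop (_ : (fun s : R => 1 * cexp (- Complex y s)) =
    (fun s : R => cexp (real_complex R (- y)) * (1 * cexp (- Complex 0 s)))).
    by rewrite (cintZ _ _ _ (cauchyop_rcont (c1 0))); exact: mulrCA.
  apply/funext => s; rewrite !mul1r -cexpD; congr cexp.
  by apply/eqP; rewrite eq_complex /= oppr0 addr0 add0r !eqxx.
have E1 := cauchyop_invariant (@cder_cst R 1) ler01.
rewrite [RHS]E cexp_real in E1; rewrite E; move: E1.
move: (cauchyop 0 _) => k kE.
suff -> : k = 0 by rewrite mulr0.
have /eqP : (1 - real_complex R (expR (- 1))) * k = 0.
  by rewrite mulrBl mul1r -kE subrr.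
rewrite mulf_eq0 => /orP[|/eqP//].
rewrite subr_eq0 -(rmorph1 (real_complex R)) (inj_eq (@complexI _)).
by rewrite -[X in X == _]expR0 (inj_eq (@expR_inj R)) eq_sym oppr_eq0 oner_eq0.
Qed.

Lemma cauchyop_id x : cauchyop x id = 1.
Proof.
rewrite /cauchyop (_ : (fun y => _) = fun=> 1); last first.
  by apply/funext => y; rewrite -cexpD subrr cexp0.
have tp := twopi_gt0.
rewrite cint_cst ?(ltW tp)// mul1r subr0 mulVf//.
by rewrite -(rmorph0 (real_complex R)) (inj_eq (@complexI _)) gt_eqF.
Qed.

Theorem cauchy_formula u u' : (forall w, cder u w (u' w)) ->
  forall x, cauchyop x u = u' 0.
Proof.
move=> ud x; apply/eqP; rewrite -subr_eq0 -cabs_eq0 eq_le cabs_ge0 andbT.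
apply/ler_addgt0Pr => e e0; rewrite add0r.
have [r r0 rP] := ud 0 (e / 2) ltac:(by rewrite divr_gt0).
(* By invariance the circle may shrink below radius r, where the remainder of the affine
   approximation is at most e / 2 times the radius; the half pays for the factor 2 in
   [cauchyop_bound]. *)
pose x0 := Num.min x (ln r).
have x0r : expR x0 <= r by rewrite -[leRHS](@lnK R)// ler_expR ge_min lexx orbT.
rewrite -(@cauchyop_invariant u u' ud x0 x); last by rewrite ge_min lexx.
pose rem s := u s + (- u 0 + (- u' 0) * s).
have remc : circ_cont x0 rem.
  apply: rcontD; first exact: cder_circ_cont ud.
  apply: rcontD; first exact: rcont_cst.
  by apply: rcontZ; exact: (cder_circ_cont x0 (@cder_id R)).
have -> : cauchyop x0 u - u' 0 = cauchyop x0 rem.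
  have idc : circ_cont x0 id by exact: (cder_circ_cont x0 (@cder_id R)).
  rewrite /rem !cauchyopD ?cauchyop_cst ?cauchyopZ ?cauchyop_id ?add0r ?mulr1//.
  - exact: rcont_cst.
  - by apply: rcontZ.
  - exact: cder_circ_cont ud.
  - by apply: rcontD; [exact: rcont_cst|apply: rcontZ].
rewrite (le_trans (@cauchyop_bound x0 rem (e / 2 * expR x0) remc _))//.
  move=> s sE; rewrite -sE.
  have -> : rem s = u (0 + s) - u 0 - u' 0 * s by rewrite /rem add0r; ring.
  by apply: rP; rewrite sE.
by rewrite -!mulrA -expRD subrr expR0 mulr1 mulrC divfK.
Qed.

End CauchyIntegral.

(** * Cauchy's estimates and Taylor remainders *)

Section CauchyEstimates.
Context {R : realType}.
Variables (u u' : C R -> C R).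
Hypothesis ud : forall w, cder u w (u' w).
Implicit Types (z w t s h : C R) (r M : R).

Lemma cder_shift z w : cder (fun s => u (z + s)) w (u' (z + w)).
Proof.
have := cder_comp (cderD (cder_cst z w) (cder_id w)) (ud (z + w)).
by rewrite add0r mulr1.
Qed.

Lemma cauchy_formula_at x z : u' z = cauchyop x (fun s => u (z + s)).
Proof. by rewrite (cauchy_formula (cder_shift z)) addr0. Qed.

Lemma cauchy_estimate z r M : 0 < r ->
  (forall w, cabs w <= r -> cabs (u (z + w)) <= M) -> cabs (u' z) <= 2 * M / r.
Proof.
move=> r0 uM; rewrite (cauchy_formula_at (ln r)).
have -> : r^-1 = expR (- ln r) by rewrite expRN lnK.
apply: cauchyop_bound; first exact: cder_circ_cont (cder_shift z).
by move=> s; rewrite lnK// => sE; apply: uM; rewrite sE.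
Qed.

Lemma ler_cabs_scale (x : R) z : 0 <= x <= 1 -> cabs (real_complex R x * z) <= cabs z.
Proof.
by move=> /andP[x0 x1]; rewrite cabsM cabs_real ger0_norm// ler_piMl ?cabs_ge0.
Qed.

Lemma cder_lipschitz z r M h : 0 < r -> cabs h <= r ->
  (forall w, cabs w <= 2 * r -> cabs (u (z + w)) <= M) ->
  cabs (u (z + h) - u z) <= 2 * M / r * cabs h.
Proof.
move=> r0 hr uM; have -> : cabs h = cabs (z + h - z) by rewrite addrC addKr.
apply: mean_value_bound => s s01; exists (u' (z + real_complex R s * (z + h - z))) => //.
rewrite [z + h]addrC addrK.
apply: cauchy_estimate => // w wr; rewrite -addrA uM//.
rewrite (le_trans (ler_cabsD _ _))// mulr_natl mulr2n lerD//.
by rewrite (le_trans (ler_cabs_scale _ s01)).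
Qed.

(** A second derivative is not yet available. Cauchy's formula is applied instead to the difference
    of two translates of u, which [cder_lipschitz] makes small on the circle. *)
Lemma cder_lipschitz_deriv z r M h : 0 < r -> cabs h <= r ->
  (forall w, cabs w <= 3 * r -> cabs (u (z + w)) <= M) ->
  cabs (u' (z + h) - u' z) <= 4 * M / r ^+ 2 * cabs h.
Proof.
move=> r0 hr uM.
have Dd w : cder (fun s => u (h + s) - u s) w (u' (h + w) - u' w).
  by apply: cderB; [exact: cder_shift|exact: ud].
rewrite [z + h]addrC.
have -> : 4 * M / r ^+ 2 * cabs h = 2 * (2 * M / r * cabs h) / r by field; rewrite gt_eqF.
suff H : forall w, cabs w <= r -> cabs (u (h + (z + w)) - u (z + w)) <= 2 * M / r * cabs h.
  rewrite (_ : u' (h + z) - u' z = cauchyop (ln r) (fun s => u (h + (z + s)) - u (z + s))).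
    have -> : r^-1 = expR (- ln r) by rewrite expRN lnK.
    apply: cauchyop_bound => [|s].
      apply: cder_circ_cont => w; apply: cderB; last exact: cder_shift.
      have -> : (fun s => u (h + (z + s))) = (fun s => u ((h + z) + s)).
        by apply/funext => s; rewrite addrA.
      exact: cder_shift.
    rewrite lnK// => sE; have := H s; rewrite sE lexx => /(_ isT).
    by rewrite expRN lnK.
  have dd w : cder (fun s => u (h + (z + s)) - u (z + s)) w (u' ((h + z) + w) - u' (z + w)).
    apply: cderB; last exact: cder_shift.
    have -> : (fun s => u (h + (z + s))) = (fun s => u ((h + z) + s)).
      by apply/funext => s; rewrite addrA.
    exact: cder_shift.
  by rewrite (cauchy_formula dd) !addr0.
move=> w wr; rewrite (addrC h); apply: cder_lipschitz => // v vr.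
rewrite -addrA uM// (_ : 3 * r = r + 2 * r); last by ring.
by rewrite (le_trans (ler_cabsD _ _))// lerD.
Qed.

(** The constant depends only on a bound of u near z, so the remainder is uniform in any further
    parameter; this is what differentiation under the integral asks for. *)
Lemma cder_taylor2 z r M h : 0 < r -> cabs h <= r ->
  (forall w, cabs w <= 3 * r -> cabs (u (z + w)) <= M) ->
  cabs (u (z + h) - u z - u' z * h) <= 4 * M / r ^+ 2 * cabs h ^+ 2.
Proof.
move=> r0 hr uM.
have M0 : 0 <= M by rewrite (le_trans (cabs_ge0 _) (uM 0 _))// cabs0 mulr_ge0// ltW.
pose g s := u s - u' z * s.
have gd w : cder g w (u' w - u' z).
  have := cderB (ud w) (cderZ (u' z) (cder_id w)); by rewrite mulr1.
have -> : u (z + h) - u z - u' z * h = g (z + h) - g z by rewrite /g; ring.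
have hE : cabs (z + h - z) = cabs h by rewrite [z + h]addrC addrK.
rewrite expr2 mulrA -[X in _ <= _ * X]hE.
apply: mean_value_bound => s s01; exists (u' (z + real_complex R s * (z + h - z)) - u' z) => //.
rewrite [z + h]addrC addrK.
rewrite (le_trans (@cder_lipschitz_deriv _ r M _ _ _ _))//.
  exact: le_trans (ler_cabs_scale _ s01) hr.
by rewrite ler_wpM2l ?ler_cabs_scale// divr_ge0 ?mulr_ge0 ?exprn_ge0// ltW.
Qed.

End CauchyEstimates.

(** * Liouville's theorem *)

Section Boundedness.
Context {R : realType}.
Local Open Scope classical_set_scope.

Lemma compact_square (rho : R) :
  compact [set z : C R | `|complex.Re z| <= rho /\ `|complex.Im z| <= rho].
Proof.
pose f (p : R * R) : C R := Complex p.1 p.2.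
have fc : continuous f.
  move=> p; apply/cvgrPdist_le => e e0.
  have eE : e = real_complex R (complex.Re e) by rewrite RRe_real// gtr0_real.
  have e0' : 0 < complex.Re e by rewrite -ltcR -eE.
  have e20 : 0 < complex.Re e / 2 by rewrite divr_gt0.
  exists (ball p.1 (complex.Re e / 2), ball p.2 (complex.Re e / 2)).
    by split; exact: nbhsx_ballx.
  move=> q [] /=; rewrite /ball /= => /ltW q1 /ltW q2; rewrite normr_cabs eE lecR.
  by rewrite (le_trans (cabs_le_ReIm _))//= [complex.Re e]splitr lerD.
rewrite (_ : [set _ | _] = f @` (`[- rho, rho] `*` `[- rho, rho])).
  apply: continuous_compact; first exact: continuous_subspaceT.
  by apply: compact_setX; exact: segment_compact.
rewrite predeqE => -[x y]; split => /=.
  by rewrite !ler_norml => -[x1 x2]; exists (x, y) => //; split; rewrite /= in_itv.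
by move=> [[a b] [/=]]; rewrite !in_itv /= => ax bx [<- <-]; rewrite !ler_norml.
Qed.

Lemma ler_dist_cabs (z w : C R) : `|cabs z - cabs w| <= cabs (z - w).
Proof.
rewrite ler_norml ler_cabs_dist andbT lerNl opprB cabs_distC.
exact: ler_cabs_dist.
Qed.

Lemma compact_cabs_bound (T : topologicalType) (A : set T) (F : T -> C R) :
  compact A -> continuous F -> exists M : R, forall z, A z -> cabs (F z) <= M.
Proof.
move=> Ac Fc; have [A0|/set0P/negP/negPn/eqP A0] := pselect (A !=set0); last first.
  by exists 0 => z; rewrite A0.
have Gc : continuous (fun z => cabs (F z)).
  move=> z; apply/cvgrPdist_le => e e0.
  have := Fc z => /cvgrPdist_le /(_ (real_complex R e)); rewrite ltcR => /(_ e0).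
  apply: filterS => y; rewrite normr_cabs lecR; apply: le_trans.
  exact: ler_dist_cabs.
have [c _ cP] := compact_EVT_max A0 Ac (continuous_subspaceT Gc).
by exists (cabs (F c)) => z /mem_set /cP.
Qed.

Lemma polydisc_bound m (F : 'rV[C R]_m -> C R) (rho : R) : continuous F ->
  exists M : R, forall z : 'rV[C R]_m, (forall k, cabs (z 0 k) <= rho) -> cabs (F z) <= M.
Proof.
move=> Fc.
have [M MP] := compact_cabs_bound (@rV_compact (C R) m (fun=> _) (fun=> @compact_square rho)) Fc.
exists M => z zr; apply: MP => /= k.
by split; apply: le_trans (zr k); [exact: normr_Re_le|exact: normr_Im_le].
Qed.

End Boundedness.

Section Holomorphic.
Context {R : realType}.
Implicit Types (u : C R -> C R) (z w t s h : C R) (r M rho : R).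

Definition holo u := forall t, exists d, cder u t d.

Definition dc u t : C R := xget 0 (fun d => cder u t d).

Lemma dcP u t : holo u -> cder u t (dc u t).
Proof. by move=> uh; rewrite /dc; case: xgetP => // H; have [d /H] := uh t. Qed.

Lemma dc_eq u t d : cder u t d -> dc u t = d.
Proof.
move=> ud; have H : cder u t (dc u t).
  by rewrite /dc; case: xgetP => // /(_ d)/(_ ud).
exact: cder_uniq H ud.
Qed.

Lemma holo_bound u rho : holo u -> exists M, forall t, cabs t <= rho -> cabs (u t) <= M.
Proof.
move=> uh; have uc : continuous u.
  move=> t; apply: differentiable_continuous; apply/derivable1_diffP.
  by have [d /cderP[]] := uh t.
have [M MP] := compact_cabs_bound (@compact_square R rho) uc.
exists M => t tr; apply: MP.
by split; apply: le_trans tr; [exact: normr_Re_le|exact: normr_Im_le].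
Qed.

Lemma holo_circ_cont x u : holo u -> circ_cont x u.
Proof. by move=> uh; apply: cder_circ_cont => w; exact: dcP. Qed.

Lemma rcont_comp (f : R -> C R) u :
  (forall z e, 0 < e -> exists2 r, 0 < r & forall h, cabs h <= r -> cabs (u (z + h) - u z) <= e) ->
  rcont f -> rcont (fun y => u (f y)).
Proof.
move=> uc fc y e e0; have [r r0 rP] := uc (f y) e e0.
have [s s0 sP] := fc y r r0; exists s => // h /sP /rP.
by rewrite [f y + _]addrC subrK.
Qed.

(** A quadratic remainder, uniform on the circle, does the work of dominated convergence. *)
Lemma cder_cauchyop x (G : C R -> C R -> C R) (Gd : C R -> C R) t K rho :
  0 < rho -> (forall t', circ_cont x (G t')) -> circ_cont x Gd ->
  (forall h s, cabs h <= rho -> cabs s = expR x ->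
    cabs (G (t + h) s - G t s - Gd s * h) <= K * cabs h ^+ 2) ->
  cder (fun t' => cauchyop x (G t')) t (cauchyop x Gd).
Proof.
move=> rho0 Gc Gdc GP e e0.
have K0 : 0 <= K.
  have := GP (real_complex R rho) (cexp (real_complex R x)).
  rewrite cabs_real gtr0_norm// lexx cabs_cexp => /(_ isT erefl) H.
  by rewrite -(pmulr_lge0 _ (exprn_gt0 2 rho0)) (le_trans (cabs_ge0 _) H).
have D0 : 0 < 2 * K * expR (- x) + 1 by rewrite ltr_wpDl// !mulr_ge0// expR_ge0.
exists (Num.min rho (e / (2 * K * expR (- x) + 1))) => [|h].
  by rewrite lt_min rho0 divr_gt0.
rewrite le_min => /andP[h1]; rewrite ler_pdivlMr// => h2.
pose D s := (G (t + h) s + (-1) * G t s) + (- h) * Gd s.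
have Dc1 : circ_cont x (fun s => G (t + h) s + (-1) * G t s).
  by apply: rcontD; [exact: Gc|apply: rcontZ; exact: Gc].
have Dc2 : circ_cont x (fun s => (- h) * Gd s) by apply: rcontZ.
have Dc3 : circ_cont x (fun s => (-1) * G t s) by apply: rcontZ; exact: Gc.
have -> : cauchyop x (G (t + h)) - cauchyop x (G t) - cauchyop x Gd * h = cauchyop x D.
  rewrite /D (cauchyopD Dc1 Dc2) (cauchyopD (Gc _) Dc3) (cauchyopZ _ (Gc t)) (cauchyopZ _ Gdc).
  by rewrite mulN1r mulNr (mulrC h).
have Dc : circ_cont x D by apply: rcontD.
rewrite (le_trans (@cauchyop_bound _ x D (K * cabs h ^+ 2) Dc _))//.
  by move=> s sE; have := GP h s h1 sE; rewrite /D mulN1r mulNr (mulrC h).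
rewrite (_ : 2 * (K * cabs h ^+ 2) * expR (- x) =
  2 * K * expR (- x) * cabs h * cabs h); last by ring.
rewrite ler_wpM2r ?cabs_ge0// (le_trans _ h2)// mulrC ler_wpM2l ?cabs_ge0//.
by rewrite lerDl.
Qed.

(* Differentiating Cauchy's formula under the integral sign: a mixed derivative
   of a separately holomorphic, locally bounded function of two variables. *)
Lemma holo_dc2 (v : C R -> C R -> C R) : (forall t, holo (v t)) ->
  (forall s, holo (fun t => v t s)) ->
  (forall rho, exists M, forall t s, cabs t <= rho -> cabs s <= rho -> cabs (v t s) <= M) ->
  holo (fun t => dc (v t) 0).
Proof.
move=> v2 v1 vb t.
exists (cauchyop 0 (fun s => dc (fun t' => v t' s) t)).
have -> : (fun t => dc (v t) 0) = (fun t => cauchyop 0 (v t)).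
  by apply/funext => t'; rewrite (cauchy_formula (fun w => dcP w (v2 t'))).
have [M MP] := vb (cabs t + 4).
apply: (@cder_cauchyop 0 v _ t (4 * M / 1 ^+ 2) 1) => //.
- by move=> t'; exact: holo_circ_cont.
- apply: rcont_comp; last first.
    exact: (holo_circ_cont 0 (fun t => ex_intro _ _ (cder_id t))).
  (* Continuity in s of the derivative in t: Cauchy's estimate in t is applied to v t' (s + h) - v
     t' s, which is Lipschitz in h uniformly for t' near t. *)
  move=> s e e0; have [M' MP'] := vb (cabs t + cabs s + 3).
  have M'0 : 0 <= M'.
    by apply: le_trans (cabs_ge0 _) (MP' 0 0 _ _); rewrite cabs0 !addr_ge0 ?cabs_ge0.
  have D0 : 0 < 4 * M' + 1 by rewrite ltr_wpDl// mulr_ge0.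
  exists (Num.min 1 (e / (4 * M' + 1))) => [|h]; first by rewrite lt_min ltr01 divr_gt0.
  rewrite le_min => /andP[h1]; rewrite ler_pdivlMr// => h2.
  have dd w : cder (fun t' => v t' (s + h) - v t' s) w
      (dc (fun t' => v t' (s + h)) w - dc (fun t' => v t' s) w).
    by apply: cderB; apply: dcP.
  rewrite (le_trans (@cauchy_estimate _ _ _ dd t 1 (2 * M' / 1 * cabs h) _ _))//.
    move=> w w1; have tw : cabs (t + w) <= cabs t + 1.
      by rewrite (le_trans (ler_cabsD _ _))// lerD2l.
    have c0 := cabs_ge0 s; have c1 := cabs_ge0 t.
    apply: (@cder_lipschitz _ (v (t + w)) _ (fun w' => dcP w' (v2 _))) => //.
    move=> x x2; apply: MP'; first by rewrite (le_trans tw)//; lra.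
    by rewrite (le_trans (ler_cabsD _ _))//; lra.
  rewrite !divr1 (le_trans _ h2)// mulrA mulrC ler_wpM2l ?cabs_ge0//.
  by rewrite mulrA (_ : 2 * 2 = 4 :> R) ?lerDl//; ring.
move=> h s h1; rewrite expR0 => s1.
apply: (@cder_taylor2 _ (fun t' => v t' s) _ (fun w' => dcP w' (v1 s)) t 1) => //.
move=> w w3; apply: MP.
  by rewrite (le_trans (ler_cabsD _ _))// lerD2l (le_trans w3)// mulr1 ler_nat.
by rewrite s1 -[leLHS]add0r lerD ?cabs_ge0 ?ler1n.
Qed.

Lemma holo_shift u z : holo u -> holo (fun t => u (z + t)).
Proof. by move=> uh t; exists (dc u (z + t)); apply: cder_shift => w; exact: dcP. Qed.

Lemma dc_shift u z t : holo u -> dc (fun s => u (z + s)) t = dc u (z + t).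
Proof. by move=> uh; apply: dc_eq; apply: cder_shift => w; exact: dcP. Qed.

(** The case v t s = u (t + s) of [holo_dc2], whose derivative in s at 0 is [dc u t]. *)
Lemma holo_dc u : holo u -> holo (dc u).
Proof.
move=> uh; have -> : dc u = fun t => dc (fun s => u (t + s)) 0.
  by apply/funext => t; rewrite dc_shift// addr0.
apply: (@holo_dc2 (fun t s => u (t + s))) => [t|s|rho].
- exact: holo_shift.
- have -> : (fun t => u (t + s)) = fun t => u (s + t).
    by apply/funext => t; rewrite addrC.
  exact: holo_shift.
- have [M MP] := holo_bound (rho + rho) uh; exists M => t s tr sr; apply: MP.
  by rewrite (le_trans (ler_cabsD _ _))// lerD.
Qed.

Lemma cder_horner (p : {poly C R}) t : cder (fun s => p.[s]) t (p^`()).[t].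
Proof.
elim/poly_ind: p => [|p c IH].
  rewrite deriv0 horner0; apply: cder_eq (cder_cst 0 t) => // s.
  by rewrite horner0.
apply: cder_eq (cderD (cderM IH (cder_id t)) (cder_cst c t)) => [s|].
  by rewrite hornerMXaddC.
by rewrite derivMXaddC hornerD hornerMX /= mulr1 addr0 [X in _ + X]mulrC.
Qed.

Lemma holo_horner (p : {poly C R}) : holo (fun s => p.[s]).
Proof. by move=> t; exists (p^`()).[t]; exact: cder_horner. Qed.

Lemma cder0_cst u : (forall t, cder u t 0) -> forall t, u t = u 0.
Proof.
move=> u0 t; apply/eqP; rewrite -subr_eq0 -cabs_eq0 eq_le cabs_ge0 andbT.
rewrite -[leRHS](mul0r (cabs (t - 0))).
by apply: mean_value_bound => s _; exists 0 => //; rewrite cabs0.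
Qed.

(** Cauchy's estimate at radius 1 + |t| lowers the growth exponent of the derivative by one, so the
    derivative is a polynomial by induction; subtracting a primitive of it leaves a constant. *)
Theorem liouville K (A : R) u : holo u ->
  (forall t, cabs (u t) <= A * (1 + cabs t) ^+ K) ->
  exists2 q : {poly C R}, (size q <= K.+1)%N & forall t, u t = q.[t].
Proof.
elim: K A u => [|K IH] A u uh uA.
  have A0 : 0 <= A by rewrite (le_trans (cabs_ge0 _) (le_trans (uA 0) _))// mulr1.
  exists (u 0)%:P => [|t]; first by rewrite size_polyC; case: eqP.
  rewrite hornerC; apply: cder0_cst => {}t.
  suff <- : dc u t = 0 by exact: dcP.
  apply/eqP; rewrite -cabs_eq0 eq_le cabs_ge0 andbT.
  apply/ler_addgt0Pr => e e0; rewrite add0r.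
  (* The radius at which Cauchy's estimate equals e; A + 1 keeps it positive when A = 0. *)
  have r0 : 0 < 2 * (A + 1) / e by rewrite divr_gt0// mulr_gt0// ltr_wpDl.
  rewrite (le_trans (@cauchy_estimate _ _ _ (fun w => dcP w uh) t _ (A + 1) r0 _))//.
    by move=> w _; rewrite (le_trans (uA _))// expr0 mulr1 lerDl.
  by rewrite ler_pdivrMr// [e * _]mulrC divfK ?gt_eqF.
have A0 : 0 <= A.
  by rewrite (le_trans (cabs_ge0 _) (le_trans (uA 0) _))// cabs0 addr0 expr1n mulr1.
have [q qs qE] : exists2 q : {poly C R}, (size q <= K.+1)%N & forall t, dc u t = q.[t].
  apply: (IH (2 * A * 2 ^+ K.+1)); first exact: holo_dc.
  move=> t; have r0 : 0 < 1 + cabs t by rewrite ltr_wpDr ?cabs_ge0.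
  rewrite (le_trans (@cauchy_estimate _ _ _ (fun w => dcP w uh) t _
    (A * (2 * (1 + cabs t)) ^+ K.+1) r0 _))//.
    move=> w wr; rewrite (le_trans (uA _))// ler_wpM2l//.
    apply: lerXn2r; rewrite ?nnegrE ?addr_ge0 ?cabs_ge0 ?mulr_ge0 ?addr_ge0 ?cabs_ge0//.
    by rewrite mulr_natl mulr2n -addrA lerD2l (le_trans (ler_cabsD _ _))// lerD2l.
  rewrite ler_pdivrMr// exprMn [(1 + cabs t) ^+ K.+1]exprSr.
  by rewrite le_eqVlt; apply/orP; left; apply/eqP; ring.
pose Q : {poly C R} := \poly_(i < K.+2) (q`_i.-1 / i%:R *+ (0 < i)%N).
have QE : Q^`() = q.
  apply/polyP => i; rewrite coef_deriv coef_poly ltnS.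
  case: ltnP => [iK|iK]; last by rewrite mul0rn nth_default// (leq_trans qs).
  by rewrite /= mulr1n -[LHS]mulr_natr divfK// pnatr_eq0.
exists (Q + (u 0 - Q.[0])%:P).
  rewrite (leq_trans (size_polyD _ _))// geq_max size_poly size_polyC.
  by case: eqP.
move=> t; rewrite hornerD hornerC.
have : u t - Q.[t] = u 0 - Q.[0].
  apply: (@cder0_cst (fun t => u t - Q.[t])) => s.
  rewrite -(subrr q.[s]) -{1}qE -QE; apply: cderB; first exact: dcP.
  exact: cder_horner.
by move=> <-; rewrite addrC subrK.
Qed.

End Holomorphic.

(** * Holomorphic functions and polynomials of several variables *)

Section SeparatelyHolomorphic.
Context {R : realType} {m : nat}.
Local Open Scope classical_set_scope.
Implicit Types (f g : 'rV[C R]_m -> C R) (z v w : 'rV[C R]_m).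

Lemma cder_lineP f z v t d :
  is_derive (z + t *: v) v f d <-> cder (fun s => f (z + s *: v)) t d.
Proof.
have E : (fun h : C R => h^-1 *: (f (z + (h *: 1 + t) *: v) - f (z + t *: v))) =
         (fun h : C R => h^-1 *: (f (h *: v + (z + t *: v)) - f (z + t *: v))).
  apply/funext => h; congr (_ *: (f _ - _)).
  by rewrite scalerDl addrCA /GRing.scale/= mulr1.
split.
  move=> [ex dE]; apply/cderP; split.
    by move: ex; rewrite /derivable -E.
  by rewrite -dE /derive -E.
move=> /cderP[ex dE]; split.
  by move: ex; rewrite /derivable -E.
by rewrite -dE /derive -E.
Qed.

Definition polydisc (rho : R) v := forall k, cabs (v 0 k) <= rho.

(** A class that partial derivatives preserve by one-variable arguments alone: Cauchy's formula in
    one coordinate at a time, with local bounds in place of joint differentiability. *)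
Definition sepholo g :=
  (forall z k, holo (fun t => g (z + t *: delta_mx 0 k))) /\
  (forall rho, exists M : R, forall z, polydisc rho z -> cabs (g z) <= M).

Lemma entire_line f z v : entire f -> holo (fun t => f (z + t *: v)).
Proof.
move=> fe t; exists ('D_v f (z + t *: v)); apply/cder_lineP.
by apply: derivableP; apply: diff_derivable; exact: fe.
Qed.

Lemma entire_sepholo f : entire f -> sepholo f.
Proof.
move=> fe; split=> [z k|rho]; first exact: entire_line.
by apply: polydisc_bound => z; exact: differentiable_continuous.
Qed.

Lemma pderivE g k z : sepholo g ->
  pderiv k g z = dc (fun t => g (z + t *: delta_mx 0 k)) 0.
Proof.
move=> [gh _]; have /cder_lineP[] := dcP 0 (gh z k).
by rewrite scale0r addr0.
Qed.

Lemma cabs_delta (t : C R) (k j : 'I_m) : cabs ((t *: delta_mx 0 k : 'rV[C R]_m) 0 j) <= cabs t.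
Proof.
rewrite !mxE eqxx /= cabsM ler_piMr ?cabs_ge0//.
by case: (_ == _); rewrite ?cabs1 ?cabs0.
Qed.

Lemma polydiscD (r s : R) v w : polydisc r v -> polydisc s w -> polydisc (r + s) (v + w).
Proof. by move=> vr ws k; rewrite mxE (le_trans (ler_cabsD _ _))// lerD. Qed.

Lemma polydisc_delta (t : C R) (k : 'I_m) (r : R) : cabs t <= r ->
  polydisc r (t *: delta_mx 0 k).
Proof. by move=> tr j; rewrite (le_trans (cabs_delta _ _ _)). Qed.

Lemma polydisc_ex z : exists rho : R, 0 <= rho /\ polydisc rho z.
Proof.
exists (\sum_k cabs (z 0 k)); split=> [|k]; first by rewrite sumr_ge0// => *; exact: cabs_ge0.
by rewrite (bigD1 k)//= lerDl sumr_ge0// => *; exact: cabs_ge0.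
Qed.

Lemma sepholo_pderiv g k : sepholo g -> sepholo (pderiv k g).
Proof.
move=> gs; have [gh gb] := gs; split=> [z j|rho].
  have -> : (fun t => pderiv k g (z + t *: delta_mx 0 j)) =
     (fun t => dc (fun s => g (z + t *: delta_mx 0 j + s *: delta_mx 0 k)) 0).
    by apply/funext => t; rewrite pderivE.
  apply: (@holo_dc2 R (fun t s => g (z + t *: delta_mx 0 j + s *: delta_mx 0 k))) => [t|s|rho].
  - exact: gh.
  - have -> : (fun t => g (z + t *: delta_mx 0 j + s *: delta_mx 0 k)) =
       (fun t => g ((z + s *: delta_mx 0 k) + t *: delta_mx 0 j)).
      by apply/funext => t; rewrite addrAC.
    exact: gh.
  - have [r [_ zr]] := polydisc_ex z; have [M MP] := gb (r + rho + rho).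
    exists M => t s tr sr; apply: MP.
    by apply: polydiscD; [apply: polydiscD|]; rewrite //; exact: polydisc_delta.
have [M MP] := gb (rho + 1); exists (2 * M / 1) => z zr.
rewrite pderivE//.
have H := @cauchy_estimate _ _ _ (fun x => dcP x (gh z k)) 0 1 M ltr01.
apply: H => w w1.
by rewrite add0r; apply: MP; apply: polydiscD => //; exact: polydisc_delta.
Qed.

Lemma pderivm_ind (Q : ('rV[C R]_m -> C R) -> Prop) f (nu : mindex m) : Q f ->
  (forall k g, Q g -> Q (pderiv k g)) -> Q (pderivm nu f).
Proof.
move=> Qf Qd; rewrite /pderivm; elim: (enum _) => //= k s IH.
by elim: (nu k) => //= n; exact: Qd.
Qed.

(** Each derivation spends half of the radius that is left. The constants are uniform in z, and the
    power of dl is kept explicit because [growth] lets the radius tend to 0. *)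
Lemma pderivm_estimate f (nu : mindex m) : sepholo f ->
  exists C0 : R, exists a : nat, 0 <= C0 /\ forall z (dl M : R), 0 < dl -> dl <= 1 ->
    (forall v, polydisc dl v -> cabs (f (z + v)) <= M) ->
    cabs (pderivm nu f z) <= C0 * dl ^- a * M.
Proof.
move=> fs; pose Q g := sepholo g /\
  exists C0 : R, exists a : nat, 0 <= C0 /\ forall z (dl M : R), 0 < dl -> dl <= 1 ->
    (forall v, polydisc dl v -> cabs (f (z + v)) <= M) ->
    cabs (g z) <= C0 * dl ^- a * M.
suff [] : Q (pderivm nu f) by [].
apply: pderivm_ind => [|k g [gs [C0 [a [C00 gP]]]]].
  split=> //; exists 1, 0%N; split=> // z dl M dl0 _ fM.
  rewrite expr0 invr1 !mul1r -[z in cabs (f z)]addr0; apply: fM => j.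
  by rewrite mxE cabs0 ltW.
split; first exact: sepholo_pderiv.
exists (4 * C0 * 2 ^+ a), a.+1; split=> [|z dl M dl0 dl1 fM].
  by rewrite !mulr_ge0// exprn_ge0.
have d20 : 0 < dl / 2 by rewrite divr_gt0.
have d21 : dl / 2 <= 1 by rewrite ler_pdivrMr// mul1r (le_trans dl1)// ler1n.
rewrite pderivE//.
have -> : 4 * C0 * 2 ^+ a * dl ^- a.+1 * M = 2 * (C0 * (dl / 2) ^- a * M) / (dl / 2).
  have -> : (dl / 2) ^- a = 2 ^+ a * dl ^- a by rewrite expr_div_n invf_div.
  rewrite exprS; field.
  by rewrite gt_eqF// expf_neq0// gt_eqF.
apply: (@cauchy_estimate _ _ _ (fun x => dcP x (gs.1 z k))) => // w wd.
rewrite add0r; apply: gP => // v vd; rewrite -addrA; apply: fM.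
by rewrite [dl]splitr; apply: polydiscD => //; exact: polydisc_delta.
Qed.

End SeparatelyHolomorphic.

(** * Polynomial functions and polynomial growth *)

Section Polynomials.
Context {R : realType} {m : nat}.
Local Open Scope classical_set_scope.
Implicit Types (p q : cpoly R m) (z v w : 'rV[C R]_m).

Lemma cpoly_ind (P : cpoly R m -> Prop) :
  (forall c, P (mpoly.mpolyC m c)) -> (forall i, P (mpoly.mpolyX _ (mpoly.mnm1 i))) ->
  (forall p q, P p -> P q -> P (p + q)) -> (forall p q, P p -> P q -> P (p * q)) ->
  forall p, P p.
Proof.
move=> PC PX PD PM; elim/mpoly.mpolyind => [|c mu p _ _ Pp].
  by rewrite -(mpoly.mpolyC0 m (C R)).
apply: (PD) => //; rewrite -mpoly.mul_mpolyC; apply: (PM) => //.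
rewrite mpoly.mpolyXE_id; apply: (big_ind P _ PM).
  by rewrite -(mpoly.mpolyC1 m (C R)).
move=> i _; elim: (mu i) => [|n IH].
  by rewrite expr0 -(mpoly.mpolyC1 m (C R)).
by rewrite exprS; exact: PM.
Qed.

Lemma pevalC c z : peval (mpoly.mpolyC m c) z = c.
Proof. exact: mpoly.mevalC. Qed.
Lemma pevalXU i z : peval (mpoly.mpolyX _ (mpoly.mnm1 i)) z = z 0 i.
Proof. exact: mpoly.mevalXU. Qed.
Lemma pevalD p q z : peval (p + q) z = peval p z + peval q z.
Proof. exact: mpoly.mevalD. Qed.
Lemma pevalB p q z : peval (p - q) z = peval p z - peval q z.
Proof. exact: mpoly.mevalB. Qed.
Lemma pevalM p q z : peval (p * q) z = peval p z * peval q z.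
Proof. exact: mpoly.mevalM. Qed.
Lemma pevalXn p n z : peval (p ^+ n) z = peval p z ^+ n.
Proof.
elim: n => [|n IH]; last by rewrite !exprS pevalM IH.
by rewrite !expr0 -(mpoly.mpolyC1 m (C R)) pevalC.
Qed.
Lemma peval0 z : peval 0 z = 0.
Proof. exact: mpoly.meval0. Qed.

Definition vsize z : R := \sum_k cabs (z 0 k).

Lemma vsize_ge0 z : 0 <= vsize z.
Proof. by rewrite sumr_ge0// => *; exact: cabs_ge0. Qed.

Lemma vsizeD z w : vsize (z + w) <= vsize z + vsize w.
Proof. by rewrite /vsize -big_split/= ler_sum// => k _; rewrite mxE ler_cabsD. Qed.

Lemma vsizeZ t z : vsize (t *: z) = cabs t * vsize z.
Proof. by rewrite /vsize mulr_sumr; apply: eq_bigr => k _; rewrite mxE cabsM. Qed.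

Lemma cabs_vsize z k : cabs (z 0 k) <= vsize z.
Proof. by rewrite /vsize (bigD1 k)//= lerDl sumr_ge0// => *; exact: cabs_ge0. Qed.

Lemma vsize_polydisc (r : R) v : polydisc r v -> vsize v <= m%:R * r.
Proof.
move=> vr; rewrite (le_trans (ler_sum _ (fun k _ => vr k)))//.
by rewrite sumr_const card_ord mulr_natl.
Qed.

Definition pgrowth (F : 'rV[C R]_m -> R) := exists (A : R) (K : nat),
  0 <= A /\ forall z, F z <= A * (1 + vsize z) ^+ K.

Lemma ler_1D_exp (x : R) (K K' : nat) : 0 <= x -> (K <= K')%N -> (1 + x) ^+ K <= (1 + x) ^+ K'.
Proof. by move=> x0 KK; rewrite ler_weXn2l// lerDl. Qed.

Lemma pgrowthD (F G : 'rV[C R]_m -> R) : pgrowth F -> pgrowth G -> pgrowth (fun z => F z + G z).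
Proof.
move=> [A [K [A0 FA]]] [B [L [B0 GB]]]; exists (A + B), (K + L)%N; split=> [|z].
  exact: addr_ge0.
rewrite mulrDl lerD//.
  by rewrite (le_trans (FA z))// ler_wpM2l// ler_1D_exp ?vsize_ge0 ?leq_addr.
by rewrite (le_trans (GB z))// ler_wpM2l// ler_1D_exp ?vsize_ge0 ?leq_addl.
Qed.

Lemma pgrowthM (F G : 'rV[C R]_m -> R) : (forall z, 0 <= F z) -> (forall z, 0 <= G z) ->
  pgrowth F -> pgrowth G -> pgrowth (fun z => F z * G z).
Proof.
move=> F0 G0 [A [K [A0 FA]]] [B [L [B0 GB]]]; exists (A * B), (K + L)%N; split=> [|z].
  exact: mulr_ge0.
by rewrite exprD mulrACA ler_pM.
Qed.

Lemma pgrowth_le (F G : 'rV[C R]_m -> R) : (forall z, F z <= G z) -> pgrowth G -> pgrowth F.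
Proof.
move=> FG [A [K [A0 GA]]]; exists A, K; split=> // z.
exact: le_trans (FG z) (GA z).
Qed.

Lemma pgrowth_peval p : pgrowth (fun z => cabs (peval p z)).
Proof.
elim/cpoly_ind: p => [c|i|p q IHp IHq|p q IHp IHq].
- exists (cabs c), 0%N; split=> [|z]; first exact: cabs_ge0.
  by rewrite pevalC expr0 mulr1.
- exists 1, 1%N; split=> // z; rewrite pevalXU expr1 mul1r.
  by rewrite (le_trans (cabs_vsize _ _))// lerDr.
- apply: pgrowth_le (pgrowthD IHp IHq) => z.
  by rewrite pevalD ler_cabsD.
- apply: pgrowth_le (pgrowthM _ _ IHp IHq) => z; rewrite ?cabs_ge0//.
  by rewrite pevalM cabsM.
Qed.

Lemma peval_line p z v : exists q : {poly C R}, forall t, peval p (z + t *: v) = q.[t].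
Proof.
elim/cpoly_ind: p => [c|i|p q [p1 IHp] [q1 IHq]|p q [p1 IHp] [q1 IHq]].
- by exists c%:P => t; rewrite pevalC hornerC.
- exists ((z 0 i)%:P + (v 0 i) *: 'X) => t.
  by rewrite pevalXU !mxE hornerD hornerC hornerZ hornerX mulrC.
- by exists (p1 + q1) => t; rewrite pevalD IHp IHq hornerD.
- by exists (p1 * q1) => t; rewrite pevalM IHp IHq hornerM.
Qed.

Lemma entire_peval p : entire (peval p).
Proof.
move=> z; elim/cpoly_ind: p => [c|i|p q IHp IHq|p q IHp IHq].
- have -> : peval (mpoly.mpolyC m c) = cst c by apply/funext => w; rewrite pevalC.
  exact: differentiable_cst.
- have -> : peval (mpoly.mpolyX _ (mpoly.mnm1 i)) = (fun w : 'rV[C R]_m => w 0 i).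
    by apply/funext => w; rewrite pevalXU.
  exact: differentiable_coord.
- have -> : peval (p + q) = peval p + peval q by apply/funext => w; rewrite pevalD.
  exact: differentiableD.
- have -> : peval (p * q) = peval p * peval q by apply/funext => w; rewrite pevalM.
  exact: differentiableM.
Qed.

Lemma pderiv_peval p k : exists q, forall z,
  is_derive z (delta_mx 0 k : 'rV[C R]_m) (peval p) (peval q z).
Proof.
elim/cpoly_ind: p => [c|i|p q [p1 IHp] [q1 IHq]|p q [p1 IHp] [q1 IHq]].
- exists 0 => z.
  have -> : peval (mpoly.mpolyC m c) = cst c by apply/funext => w; rewrite pevalC.
  rewrite peval0; exact: is_derive_cst.
- exists (mpoly.mpolyC m (i == k)%:R) => z.
  rewrite -[z]addr0 -(scale0r (delta_mx 0 k)) pevalC; apply/cder_lineP.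
  apply: cder_eq (cder_affine (z 0 i) (i == k)%:R 0) => // t.
  by rewrite pevalXU !mxE eqxx.
- exists (p1 + q1) => z; rewrite pevalD.
  have -> : peval (p + q) = peval p + peval q by apply/funext => w; rewrite pevalD.
  exact: is_deriveD.
- exists (p * q1 + q * p1) => z; rewrite pevalD !pevalM.
  have -> : peval (p * q) = peval p * peval q by apply/funext => w; rewrite pevalM.
  exact: is_deriveM.
Qed.

End Polynomials.

Section NonVanishing.
Context {R : realType}.

Lemma poly_neq0_ex (q : {poly C R}) : q != 0 -> exists x, q.[x] != 0.
Proof.
move=> q0; have [/allP H|] := boolP (all (root q) [seq i%:R | i <- iota 0 (size q)]).
  have := max_poly_roots q0 (introT allP H).
  rewrite map_inj_uniq ?iota_uniq => [/(_ isT)|]; last first.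
    by move=> i j /eqP; rewrite eqr_nat => /eqP.
  by rewrite size_map size_iota ltnn.
by rewrite -has_predC => /hasP[x _ xP]; exists x.
Qed.

(** Uniqueness of expansions in base D, read off modulo D; it makes Kronecker's substitution
    injective on the monomials of a given polynomial. *)
Lemma base_digits_inj (D m : nat) (a b : 'I_m -> nat) :
  (forall i, a i < D)%N -> (forall i, b i < D)%N ->
  (\sum_i a i * D ^ i = \sum_i b i * D ^ i)%N -> a =1 b.
Proof.
elim: m a b => [a b _ _ _ []//|m IH a b aD bD].
have D0 : (0 < D)%N by exact: leq_ltn_trans (aD ord0).
have E (c : 'I_m.+1 -> nat) : (\sum_i c i * D ^ i = c ord0 + (\sum_i c (lift ord0 i) * D ^ i) * D)%N.
  rewrite big_ord_recl expn0 muln1 big_distrl /=; congr addn.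
  by apply: eq_bigr => i _; rewrite /bump /= add1n expnSr mulnA.
rewrite !E => H.
have H0 : a ord0 = b ord0.
  by have := congr1 (modn^~ D) H; rewrite /= [(a ord0 + _)%N]addnC modnMDl [(b ord0 + _)%N]addnC modnMDl !modn_small.
have HS : (\sum_i a (lift ord0 i) * D ^ i = \sum_i b (lift ord0 i) * D ^ i)%N.
  by have /eqP := H; rewrite H0 eqn_add2l eqn_pmul2r// => /eqP.
move=> i; have [j ->|->//] := unliftP ord0 i.
exact: (IH _ _ (fun i => aD _) (fun i => bD _) HS).
Qed.

(* Kronecker's substitution of z_k by t^(D^k). *)
Lemma cpoly_neq0_ex m (p : cpoly R m) : p != 0 -> exists z, peval p z != 0.
Proof.
move=> p0; pose D := mpoly.msize p.
pose kap (mu : mindex m) := (\sum_i mu i * D ^ i)%N.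
have kapI : {in mpoly.msupp p &, injective kap}.
  move=> mu nu mup nup /base_digits_inj H; apply/mpoly.mnmP; apply: H => i.
    apply: leq_ltn_trans (mpoly.msize_mdeg_lt mup).
    by rewrite mpoly.mdegE (bigD1 i)//= leq_addr.
  apply: leq_ltn_trans (mpoly.msize_mdeg_lt nup).
  by rewrite mpoly.mdegE (bigD1 i)//= leq_addr.
pose q : {poly C R} := \sum_(mu <- mpoly.msupp p) mpoly.mcoeff mu p *: 'X^(kap mu).
have [mu mup] : exists mu, mu \in mpoly.msupp p.
  case E: (mpoly.msupp p) => [|mu s]; last by exists mu; rewrite inE eqxx.
  by move/eqP: E; rewrite mpoly.msupp_eq0 (negPf p0).
have q0 : q != 0.
  apply/eqP => /(congr1 (fun q : {poly C R} => q`_(kap mu))).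
  rewrite coef0 coef_sum (bigD1_seq mu)//= ?mpoly.msupp_uniq//.
  rewrite coefZ coefXn eqxx mulr1 big_seq_cond big1 ?addr0 => [/eqP|nu /andP[nup nn]].
    by rewrite mpoly.mcoeff_eq0 mup.
  rewrite coefZ coefXn; case: eqP => [E|]; rewrite ?mulr0//.
  by rewrite (kapI _ _ mup nup E) eqxx in nn.
have [t tq] := poly_neq0_ex q0.
exists (\row_k t ^+ (D ^ k)); apply: contraNneq tq => {}H.
rewrite -H /peval mpoly.mevalE /q horner_sum; apply/eqP/eq_bigr => nu _.
rewrite hornerZ hornerXn; congr (_ * _); rewrite /kap expr_sum.
by apply: eq_bigr => i _; rewrite mxE -exprM mulnC.
Qed.

Lemma cpoly_ext m (p q : cpoly R m) : (forall z, peval p z = peval q z) -> p = q.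
Proof.
move=> pq; apply/eqP; rewrite -subr_eq0; apply: contraT => /cpoly_neq0_ex[z].
by rewrite pevalB pq subrr eqxx.
Qed.

(** Far enough from the origin each linear factor t - r has modulus at least 1, so the leading
    coefficient alone is a lower bound. *)
Lemma poly_large (q : {poly C R}) : q != 0 -> exists c T : R, 0 < c /\
  forall t, T <= cabs t -> c <= cabs q.[t].
Proof.
move=> q0; have [rs qE] := closed_field_poly_normal q.
exists (cabs (lead_coef q)), (1 + \sum_(r <- rs) cabs r).
split=> [|t tT]; first by rewrite cabs_gt0 lead_coef_eq0.
rewrite {2}qE hornerZ cabsM ler_peMr ?cabs_ge0// horner_prod cabs_prod.
have : {in rs, forall r, 1 <= cabs (t - r)}.
  move=> r rrs; apply: le_trans (ler_cabs_dist _ _).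
  rewrite lerBrDr (le_trans _ tT)// lerD2l (big_rem r)//= lerDl.
  by rewrite sumr_ge0// => *; exact: cabs_ge0.
elim: (rs) => [|r s IH] H; first by rewrite big_nil.
rewrite big_cons hornerXsubC -[leLHS]mulr1 ler_pM ?ler01//.
  by apply: H; rewrite inE eqxx.
by apply: IH => r' r's; apply: H; rewrite inE r's orbT.
Qed.

Lemma pgrowth_horner (q : {poly C R}) : exists (A : R) (K : nat),
  0 <= A /\ forall t, cabs q.[t] <= A * (1 + cabs t) ^+ K.
Proof.
elim/poly_ind: q => [|q c [A [K [A0 qA]]]].
  by exists 0, 0%N; split=> // t; rewrite horner0 cabs0 mul0r.
exists (A + cabs c), K.+1; split=> [|t]; first by rewrite addr_ge0 ?cabs_ge0.
have t0 := cabs_ge0 t.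
have t1 : 1 <= 1 + cabs t by rewrite lerDl.
rewrite hornerMXaddC (le_trans (ler_cabsD _ _))// mulrDl lerD//; last first.
  by rewrite ler_peMr ?cabs_ge0// exprn_ege1.
rewrite cabsM exprSr mulrA ler_pM ?cabs_ge0//.
by rewrite lerDr.
Qed.

End NonVanishing.

(** * Growth of solutions *)

Section DifferentialBounds.
Context {R : realType} {m : nat}.
Variable f : 'rV[C R]_m -> C R.
Implicit Types (F G : 'rV[C R]_m -> C R) (z v w : 'rV[C R]_m).

(* [F] is controlled like a differential monomial of degree [d] in [f]. *)
Definition diff_bounded (d : nat) F := exists (A : R) (K a : nat), 0 <= A /\
  forall z (dl M : R), 0 < dl -> dl <= 1 -> 1 <= M ->
    (forall v, polydisc dl v -> cabs (f (z + v)) <= M) ->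
    cabs (F z) <= A * (1 + vsize z) ^+ K * dl ^- a * M ^+ d.

Lemma ler_Vexp (dl : R) (a b : nat) : 0 < dl -> dl <= 1 -> (a <= b)%N ->
  dl ^- a <= dl ^- b.
Proof.
move=> d0 d1 ab; rewrite lef_pV2 ?posrE ?exprn_gt0//.
by rewrite ler_wiXn2l// ltW.
Qed.

Lemma diff_bounded_peval p : diff_bounded 0 (peval p).
Proof.
have [A [K [A0 pA]]] := pgrowth_peval p.
exists A, K, 0%N; split=> // z dl M _ _ _ _.
by rewrite !expr0 invr1 !mulr1.
Qed.

Lemma diff_bounded_pderivm nu : sepholo f -> diff_bounded 1 (pderivm nu f).
Proof.
move=> /(pderivm_estimate nu)[A [a [A0 H]]].
exists A, 0%N, a; split=> // z dl M d0 d1 _ fM.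
by rewrite expr0 mulr1 expr1; exact: H.
Qed.

Lemma diff_bounded_self : diff_bounded 1 f.
Proof.
exists 1, 0%N, 0%N; split=> // z dl M d0 d1 _ fM.
rewrite !expr0 invr1 !mul1r expr1 -[z in cabs (f z)]addr0; apply: fM => k.
by rewrite mxE cabs0 ltW.
Qed.

Lemma diff_boundedW d d' F : (d <= d')%N -> diff_bounded d F -> diff_bounded d' F.
Proof.
move=> dd [A [K [a [A0 FA]]]]; exists A, K, a; split=> // z dl M d0 d1 M1 fM.
rewrite (le_trans (FA z dl M d0 d1 M1 fM))// ler_wpM2l ?ler_weXn2l//.
by rewrite !mulr_ge0 ?invr_ge0 ?exprn_ge0 ?addr_ge0 ?vsize_ge0// ltW.
Qed.

Lemma diff_boundedD d F G : diff_bounded d F -> diff_bounded d G ->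
  diff_bounded d (fun z => F z + G z).
Proof.
move=> [A [K [a [A0 FA]]]] [B [L [b [B0 GB]]]].
exists (A + B), (K + L)%N, (a + b)%N; split=> [|z dl M d0 d1 M1 fM].
  exact: addr_ge0.
have M0 : 0 <= M by exact: le_trans M1.
have z0 := vsize_ge0 z.
rewrite (le_trans (ler_cabsD _ _))// !mulrDl lerD//.
  rewrite (le_trans (FA z dl M d0 d1 M1 fM))// ler_wpM2r ?exprn_ge0//.
  rewrite ler_pM ?mulr_ge0 ?invr_ge0 ?exprn_ge0 ?addr_ge0 ?(ltW d0)//.
    by rewrite ler_wpM2l// ler_1D_exp// leq_addr.
  by rewrite ler_Vexp// leq_addr.
rewrite (le_trans (GB z dl M d0 d1 M1 fM))// ler_wpM2r ?exprn_ge0//.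
rewrite ler_pM ?mulr_ge0 ?invr_ge0 ?exprn_ge0 ?addr_ge0 ?(ltW d0)//.
  by rewrite ler_wpM2l// ler_1D_exp// leq_addl.
by rewrite ler_Vexp// leq_addl.
Qed.

Lemma diff_boundedM d d' F G : diff_bounded d F -> diff_bounded d' G ->
  diff_bounded (d + d') (fun z => F z * G z).
Proof.
move=> [A [K [a [A0 FA]]]] [B [L [b [B0 GB]]]].
exists (A * B), (K + L)%N, (a + b)%N; split=> [|z dl M d0 d1 M1 fM].
  exact: mulr_ge0.
rewrite cabsM !exprD invfM.
have -> : A * B * ((1 + vsize z) ^+ K * (1 + vsize z) ^+ L) * ((dl ^+ a)^-1 / dl ^+ b) *
   (M ^+ d * M ^+ d') = (A * (1 + vsize z) ^+ K * dl ^- a * M ^+ d) *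
   (B * (1 + vsize z) ^+ L * dl ^- b * M ^+ d') by ring.
by rewrite ler_pM ?cabs_ge0 ?FA ?GB.
Qed.

Lemma diff_boundedX d F k : diff_bounded d F -> diff_bounded (k * d) (fun z => F z ^+ k).
Proof.
move=> Fd; elim: k => [|k IH].
  exists 1, 0%N, 0%N; split=> // z dl M _ _ _ _.
  by rewrite !expr0 invr1 !mulr1 cabs1.
rewrite mulSn; have -> : (fun z => F z ^+ k.+1) = fun z => F z * F z ^+ k.
  by apply/funext => z; rewrite exprS.
exact: diff_boundedM.
Qed.

Lemma diff_bounded_sum (I : eqType) (s : seq I) d (F : I -> 'rV[C R]_m -> C R) :
  (forall i, i \in s -> diff_bounded d (F i)) ->
  diff_bounded d (fun z => \sum_(i <- s) F i z).
Proof.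
elim: s => [_|i s IH H].
  exists 0, 0%N, 0%N; split=> // z dl M _ _ _ _.
  by rewrite big_nil cabs0 !mul0r.
have -> : (fun z => \sum_(j <- i :: s) F j z) = fun z => F i z + \sum_(j <- s) F j z.
  by apply/funext => z; rewrite big_cons.
apply: diff_boundedD; first by apply: H; rewrite inE eqxx.
by apply: IH => j js; apply: H; rewrite inE js orbT.
Qed.

Lemma diff_bounded_prod (I : Type) (s : seq I) (d : I -> nat) (F : I -> 'rV[C R]_m -> C R) :
  (forall i, diff_bounded (d i) (F i)) ->
  diff_bounded (\sum_(i <- s) d i) (fun z => \prod_(i <- s) F i z).
Proof.
move=> H; elim: s => [|i s IH].
  rewrite big_nil; exists 1, 0%N, 0%N; split=> // z dl M _ _ _ _.
  by rewrite big_nil cabs1 !expr0 invr1 !mulr1.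
have -> : (fun z => \prod_(j <- i :: s) F j z) = fun z => F i z * \prod_(j <- s) F j z.
  by apply/funext => z; rewrite big_cons.
by rewrite big_cons; exact: diff_boundedM.
Qed.

(** A derivative of any order counts as one factor f, its order entering only the exponent of dl.
    Hence the exponent of M is governed by the degree of P and not by its differential order. *)
Lemma diff_bounded_dp_eval (P : diffpoly R m) d : sepholo f -> (dp_deg P <= d)%N ->
  diff_bounded d (dp_eval P f).
Proof.
move=> fs Pd; apply: diff_bounded_sum => i iI.
apply: (@diff_boundedW (0 + i ord0 * 1 + \sum_(j < dp_N P) i (lift ord0 j) * 1)%N).
  rewrite (leq_trans _ Pd)// /dp_deg.
  have -> : (0 + i ord0 * 1 + \sum_(j < dp_N P) i (lift ord0 j) * 1)%N = mpoly.mdeg i.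
    rewrite mpoly.mdegE big_ord_recl add0n muln1; congr addn.
    by apply: eq_bigr => j _; rewrite muln1.
  exact: leq_bigmax_seq.
apply: diff_boundedM.
  apply: diff_boundedM; first exact: diff_bounded_peval.
  by apply: diff_boundedX; exact: diff_bounded_self.
apply: diff_bounded_prod => j.
by apply: diff_boundedX; exact: diff_bounded_pderivm.
Qed.

End DifferentialBounds.

Section Growth.
Context {R : realType} {m : nat}.
Implicit Types (z v w alpha : 'rV[C R]_m).

Lemma pairingD alpha z w : pairing alpha (z + w) = pairing alpha z + pairing alpha w.
Proof. by rewrite /pairing -big_split; apply: eq_bigr => k _; rewrite mxE mulrDr. Qed.

Lemma pairingZ alpha t z : pairing alpha (t *: z) = t * pairing alpha z.
Proof. by rewrite /pairing mulr_sumr; apply: eq_bigr => k _; rewrite mxE mulrCA. Qed.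

Lemma cabs_pairing alpha v (r : R) : polydisc r v -> cabs (pairing alpha v) <= vsize alpha * r.
Proof.
move=> vr; rewrite (le_trans (cabs_sum _ _ _))// /vsize mulr_suml ler_sum// => k _.
by rewrite cabsM ler_wpM2l ?cabs_ge0.
Qed.

(** The expected size of a solution. Where Re L < 0 the right-hand side is small, but f^n may still
    balance P_d(f), which bounds f only polynomially; hence the positive part. *)
Definition weight (n : nat) alpha z : R :=
  expR (Num.max 0 (complex.Re (pairing alpha z)) / n%:R).

Lemma weight_ge1 n alpha z : 1 <= weight n alpha z.
Proof. by rewrite /weight -expR0 ler_expR divr_ge0// le_max lexx. Qed.

Lemma weightX n alpha z : (0 < n)%N ->
  weight n alpha z ^+ n = expR (Num.max 0 (complex.Re (pairing alpha z))).
Proof. by move=> n0; rewrite /weight -expRM_natl mulrC divfK// pnatr_eq0 -lt0n. Qed.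

Lemma weight_shift alpha z v (r : R) : polydisc r v ->
  expR (complex.Re (pairing alpha (z + v))) <=
  expR (vsize alpha * r) * expR (Num.max 0 (complex.Re (pairing alpha z))).
Proof.
move=> vr; rewrite -expRD ler_expR pairingD raddfD /= addrC lerD//; last first.
  by rewrite le_max lexx orbT.
by rewrite (le_trans (ler_norm _))// (le_trans (normr_Re_le _))// cabs_pairing.
Qed.

(* If |f(z0)| exceeded a large multiple of the weight, the equation would produce
   points within 2^-j of each other on which |f| grows geometrically, whereas f
   is bounded near z0. *)
Theorem growth n (f W : 'rV[C R]_m -> C R) (p : cpoly R m) alpha :
  sepholo f -> diff_bounded f n W ->
  (forall z, f z ^+ n.+1 + W z = peval p z * cexp (pairing alpha z)) ->
  exists (A : R) (K : nat), 0 <= A /\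
    forall z, cabs (f z) <= A * (1 + vsize z) ^+ K * weight n.+1 alpha z.
Proof.
move=> fs [AW [KW [a [AW0 WA]]]] fE.
have [Ap [Kp [Ap0 pA]]] := pgrowth_peval p.
pose m2 : R := 1 + m%:R * 2.
have m20 : 0 <= m2 by rewrite addr_ge0// mulr_ge0.
(* B collects what is lost in passing from z0 to z0 + v with v in the polydisc of radius 2: L moves
   by at most vsize alpha * 2, and 1 + vsize grows at most by the factor m2. The last summand gives
   B >= 1. *)
pose B := expR (vsize alpha * 2) * Ap * m2 ^+ Kp + AW * m2 ^+ KW + 1.
have B0 : 0 <= expR (vsize alpha * 2) * Ap * m2 ^+ Kp by rewrite !mulr_ge0 ?expR_ge0 ?exprn_ge0.
have B1 : 0 <= AW * m2 ^+ KW by rewrite mulr_ge0 ?exprn_ge0.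
have B2 : 1 <= B by rewrite lerDr addr_ge0.
(* At radius 2 ^- j the loss (2 ^- j) ^- a is at most beta ^+ j, which growth of ratio beta absorbs;
   the additional factor 2 makes beta ^+ j unbounded even when a = 0. *)
pose beta : R := 2 ^+ a.+1.
have beta1 : 1 <= beta by rewrite exprn_ege1// ler1n.
have beta0 : 0 <= beta by exact: le_trans beta1.
exists (2 * B * beta ^+ n), (Kp + KW)%N; split=> [|z0].
  by rewrite !mulr_ge0 ?exprn_ge0// (le_trans _ B2).
set S := 1 + vsize z0.
have S1 : 1 <= S by rewrite lerDl vsize_ge0.
have S0 : 0 <= S by exact: le_trans S1.
set X := B * S ^+ (Kp + KW).
have X1 : 1 <= X by rewrite mulr_ege1// exprn_ege1.
set Lam := weight n.+1 alpha z0.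
have L1 : 1 <= Lam by exact: weight_ge1.
have L0 : 0 <= Lam by exact: le_trans L1.
have LX : Lam ^+ n.+1 = expR (Num.max 0 (complex.Re (pairing alpha z0))) by exact: weightX.
have key v (dl M : R) : polydisc 2 v -> 0 < dl -> dl <= 1 -> 1 <= M ->
    (forall w, polydisc dl w -> cabs (f (z0 + v + w)) <= M) ->
    cabs (f (z0 + v)) ^+ n.+1 <= X * (Lam ^+ n.+1 + dl ^- a * M ^+ n).
  move=> v2 d0 d1 M1 fM.
  have vS : 1 + vsize (z0 + v) <= m2 * S.
    have := vsizeD z0 v; have := vsize_polydisc v2; rewrite -/m2 => H1 H2.
    have : m%:R * 2 <= (m%:R * 2) * S by rewrite ler_peMr// mulr_ge0.
    by rewrite /m2 mulrDl mul1r /S; lra.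
  have vS0 : 0 <= 1 + vsize (z0 + v) by rewrite addr_ge0// vsize_ge0.
  have vSX k : (1 + vsize (z0 + v)) ^+ k <= m2 ^+ k * S ^+ k.
    by rewrite -exprMn lerXn2r// nnegrE// mulr_ge0.
  have -> : cabs (f (z0 + v)) ^+ n.+1 =
     cabs (peval p (z0 + v) * cexp (pairing alpha (z0 + v)) - W (z0 + v)).
    by rewrite -cabsX -fE addrK.
  have dM0 : 0 <= dl ^- a * M ^+ n.
    by rewrite mulr_ge0 ?invr_ge0 ?exprn_ge0 ?(ltW d0)// (le_trans _ M1).
  have SK0 : 0 <= S ^+ (Kp + KW) by rewrite exprn_ge0.
  rewrite (le_trans (ler_cabsB _ _))// mulrDr lerD//.
    rewrite cabsM cabs_cexp LX.
    apply: le_trans (ler_pM (cabs_ge0 _) (expR_ge0 _) (pA _) (weight_shift alpha z0 v2)) _.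
    rewrite mulrA ler_wpM2r ?expR_ge0//.
    apply: (@le_trans _ _ (Ap * (m2 ^+ Kp * S ^+ Kp) * expR (vsize alpha * 2))).
      by rewrite ler_wpM2r ?expR_ge0// ler_wpM2l.
    rewrite (_ : _ * _ = (expR (vsize alpha * 2) * Ap * m2 ^+ Kp) * S ^+ Kp); last by ring.
    rewrite /X ler_pM// ?exprn_ge0//.
      by rewrite /B -addrA lerDl addr_ge0.
    by rewrite ler_weXn2l// leq_addr.
  apply: le_trans (WA _ _ _ d0 d1 M1 fM) _.
  rewrite -mulrA ler_wpM2r//.
  apply: (@le_trans _ _ (AW * (m2 ^+ KW * S ^+ KW))); first by rewrite ler_wpM2l.
  rewrite mulrA /X ler_pM// ?exprn_ge0//.
    by rewrite /B -addrA addrCA lerDl addr_ge0.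
  by rewrite ler_weXn2l// leq_addl.
(* Chosen so that 2 * X * Lam * beta ^+ j * mj j.+1 ^+ n is exactly mj j ^+ n.+1, the equality [E]
   below: one half of it pays for each summand of [key]. *)
pose D := 2 * X * beta ^+ n.
have D1 : 1 <= D by apply: mulr_ege1; [apply: mulr_ege1; rewrite ?ler1n|exact: exprn_ege1].
have D0 : 0 <= D by exact: le_trans D1.
pose mj j := Lam * D * beta ^+ j.
have mj1 j : 1 <= mj j by apply: mulr_ege1; [exact: mulr_ege1|exact: exprn_ege1].
have mjP j : X * (Lam ^+ n.+1 + (2 ^- j) ^- a * mj j.+1 ^+ n) <= mj j ^+ n.+1.
  have b2 : (2 ^- j : R) ^- a <= beta ^+ j.
    by rewrite exprVn invrK -exprM /beta -exprM ler_weXn2l ?ler1n// mulSn mulnC leq_addl.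
  apply: (@le_trans _ _ (X * (Lam ^+ n.+1 + beta ^+ j * mj j.+1 ^+ n))).
    rewrite ler_wpM2l ?(le_trans _ X1)// lerD2l ler_wpM2r// exprn_ge0//.
    exact: le_trans (mj1 _).
  have E : beta ^+ j * mj j.+1 ^+ n * X * 2 * Lam = mj j ^+ n.+1.
    rewrite /mj [beta ^+ j.+1]exprSr [RHS]exprSr.
    have DE : D = 2 * X * beta ^+ n by [].
    move: (beta ^+ j) => b; rewrite !exprMn [X in _ = _ * (_ * X * _)]DE.
    by ring.
  rewrite -E; set T := beta ^+ j * _.
  have T1 : Lam ^+ n <= T.
    have -> : T = Lam ^+ n * (beta ^+ j * (D * beta ^+ j.+1) ^+ n).
      by rewrite /T /mj !exprMn; ring.
    rewrite ler_peMr ?exprn_ge0//; apply: mulr_ege1; first exact: exprn_ege1.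
    by apply: exprn_ege1; apply: mulr_ege1 => //; exact: exprn_ege1.
  have T0 : 0 <= T by rewrite (le_trans _ T1)// exprn_ge0.
  rewrite (_ : T * X * 2 * Lam = X * (T * Lam + T * Lam)); last by ring.
  rewrite ler_wpM2l ?(le_trans _ X1)// lerD//; first by rewrite exprSr ler_wpM2r.
  by rewrite ler_peMr.
rewrite (_ : _ * _ * _ = mj 0%N); last by rewrite /mj /D /X expr0; ring.
rewrite leNgt; apply/negP => f0.
(* If |f| stayed below mj j.+1 within 2 ^- j of the current point, [key] and [mjP] would bound it
   there by mj j. The radius 2 - 2 * 2 ^- j is the sum of 2 ^- i for i < j, so the points never
   leave the polydisc of radius 2. *)
have step j : exists2 v, polydisc (2 - 2 * 2 ^- j) v & mj j < cabs (f (z0 + v)).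
  elim: j => [|j [v vj fv]].
    exists 0 => [k|]; last by rewrite addr0.
    by rewrite mxE cabs0 expr0 invr1 mulr1 subrr.
  apply: contrapT => H.
  have v2 : polydisc 2 v.
    by move=> k; rewrite (le_trans (vj k))// gerBl mulr_ge0// invr_ge0 exprn_ge0.
  have := key v (2 ^- j) (mj j.+1) v2.
  rewrite invr_gt0 exprn_gt0// invf_le1 ?exprn_gt0// exprn_ege1 ?ler1n// => /(_ isT isT (mj1 _)).
  have jM w : polydisc (2 ^- j) w -> cabs (f (z0 + v + w)) <= mj j.+1.
    move=> wj; rewrite leNgt; apply/negP => fw; apply: H; exists (v + w); last by rewrite addrA.
    rewrite (_ : 2 - _ = (2 - 2 * 2 ^- j) + 2 ^- j).
      exact: polydiscD.
    by rewrite exprS; field; rewrite expf_neq0.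
  move=> /(_ jM) /le_trans /(_ (mjP j)); rewrite leNgt => /negP; apply.
  by rewrite ltrXn2r// ?(le_trans _ (mj1 j)) // nnegrE.
have [r [_ zr]] := polydisc_ex z0.
have [M MP] := fs.2 (r + 2).
have [j jP] := exists_expn2_gt M.
have [v vj fv] := step j.
have zv : polydisc (r + 2) (z0 + v).
  by apply: polydiscD => // k; rewrite (le_trans (vj k))// gerBl mulr_ge0// invr_ge0 exprn_ge0.
have := MP _ zv; rewrite leNgt => /negP; apply.
rewrite (lt_trans _ fv)// (lt_le_trans jP)// /mj.
have b2 : 2 ^+ j <= beta ^+ j.
  by rewrite lerXn2r ?nnegrE// /beta -[leLHS]expr1 ler_weXn2l// ler1n.
have LD : 1 <= Lam * D by exact: mulr_ege1.
by rewrite -[leLHS]mul1r; apply: ler_pM => //; exact: exprn_ge0.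
Qed.

End Growth.

(** * Solutions on a complex line *)

Section HoloAlgebra.
Context {R : realType}.
Implicit Types (u v : C R -> C R) (t d : C R).

Lemma cderV u t d : u t != 0 -> cder u t d ->
  cder (fun s => (u s)^-1) t (- (u t) ^- 2 * d).
Proof.
move=> u0 /cderP[ud dE]; apply/cderP; split; first exact: derivableV.
by rewrite deriveV// dE.
Qed.

Lemma holoB u v : holo u -> holo v -> holo (fun t => u t - v t).
Proof. by move=> uh vh t; eexists; apply: cderB; exact: dcP. Qed.

Lemma holoM u v : holo u -> holo v -> holo (fun t => u t * v t).
Proof. by move=> uh vh t; eexists; apply: cderM; exact: dcP. Qed.

Lemma holoX u n : holo u -> holo (fun t => u t ^+ n).
Proof. by move=> uh t; eexists; apply: cderX; exact: dcP. Qed.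

Lemma holo_cexp u : holo u -> holo (fun t => cexp (u t)).
Proof.
by move=> uh t; eexists; apply: (cder_comp (dcP t uh)); exact: cder_cexp.
Qed.

End HoloAlgebra.

Section ExpDecay.
Context {R : realType}.

(** With M = k * K.+1, expR (x / k) is the power K.+1 of expR (x / M) >= 1 + x / M >= (1 + x) / M:
    one power of 1 + x more than the numerator has. *)
Lemma exp_decay (B : R) (K k : nat) (e : R) : (0 < k)%N -> 0 < e ->
  exists x0 : R, 0 <= x0 /\ forall x, x0 <= x -> B * (1 + x) ^+ K * expR (- (x / k%:R)) <= e.
Proof.
move=> k0 e0; pose M : R := (k * K.+1)%:R.
have M1 : 1 <= M by rewrite ler1n muln_gt0 k0.
have M0 : 0 < M by exact: lt_le_trans M1.
exists (`|B| / e * M ^+ K.+1); split=> [|x xP].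
  by rewrite mulr_ge0 ?divr_ge0 ?exprn_ge0// ltW.
have x0 : 0 <= x.
  by apply: le_trans xP; rewrite mulr_ge0 ?divr_ge0 ?exprn_ge0// ltW.
have x1 : 0 < 1 + x by rewrite ltr_wpDr.
have H : ((1 + x) / M) ^+ K.+1 <= expR (x / k%:R).
  have -> : x / k%:R = K.+1%:R * (x / M).
    by rewrite /M natrM invfM [RHS]mulrC -!mulrA mulVf ?mulr1// pnatr_eq0.
  rewrite expRM_natl lerXn2r ?nnegrE ?expR_ge0 ?divr_ge0 ?(ltW x1) ?(ltW M0)//.
  apply: le_trans (expR_ge1Dx _).
  by rewrite mulrDl mul1r lerD2r invf_le1.
rewrite expRN ler_pdivrMr ?expR_gt0//.
apply: (@le_trans _ _ (e * ((1 + x) / M) ^+ K.+1)); last by rewrite ler_wpM2l// ltW.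
rewrite expr_div_n exprSr.
apply: (@le_trans _ _ (`|B| * (1 + x) ^+ K)).
  by rewrite ler_wpM2r ?ler_norm// exprn_ge0// ltW.
have -> : e * ((1 + x) ^+ K * (1 + x) / M ^+ K.+1) =
   (e * (1 + x) / M ^+ K.+1) * (1 + x) ^+ K by ring.
rewrite ler_wpM2r ?exprn_ge0 ?(ltW x1)//.
rewrite ler_pdivlMr ?exprn_gt0// -ler_pdivrMl// mulrA [e^-1 * _]mulrC.
by rewrite (le_trans xP)// lerDr.
Qed.

End ExpDecay.

Section LineGrowth.
Context {R : realType}.
Variable n : nat.
Hypothesis n0 : (0 < n)%N.
Implicit Types (u v : C R -> C R) (t s : C R).

(** The weight on a line along which the linear form has slope 1. *)
Definition omega t : R := expR (Num.max 0 (complex.Re t) / n%:R).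

Lemma omega_ge1 t : 1 <= omega t.
Proof. by rewrite /omega -expR0 ler_expR divr_ge0// le_max lexx. Qed.

Lemma omega_shift t s : cabs s <= 1 -> omega (t + s) <= expR 1 * omega t.
Proof.
move=> s1; rewrite /omega -expRD ler_expR.
have n1 : 0 < n%:R :> R by rewrite ltr0n.
rewrite ler_pdivrMr// mulrDl divfK ?gt_eqF// mul1r.
have Rs : complex.Re s <= n%:R.
  rewrite (le_trans (ler_norm _))// (le_trans (normr_Re_le _))// (le_trans s1)//.
  by rewrite ler1n.
rewrite ge_max raddfD /= addrC lerD// ?le_max ?lexx ?orbT// andbT.
by rewrite addr_ge0// ?le_max ?lexx// ltW.
Qed.

Definition line_growth (d : nat) u := exists (A : R) (K : nat), 0 <= A /\
  forall t, cabs (u t) <= A * (1 + cabs t) ^+ K * omega t ^+ d.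

Lemma line_growthD d u v : line_growth d u -> line_growth d v ->
  line_growth d (fun t => u t + v t).
Proof.
move=> [A [K [A0 uA]]] [B [L [B0 vB]]]; exists (A + B), (K + L)%N.
split=> [|t]; first exact: addr_ge0.
have o1 := omega_ge1 t; have o0 : 0 <= omega t by exact: le_trans o1.
rewrite (le_trans (ler_cabsD _ _))// !mulrDl lerD//.
  rewrite (le_trans (uA t))// ler_wpM2r ?exprn_ge0// ler_wpM2l//.
  by rewrite ler_1D_exp ?cabs_ge0 ?leq_addr.
rewrite (le_trans (vB t))// ler_wpM2r ?exprn_ge0// ler_wpM2l//.
by rewrite ler_1D_exp ?cabs_ge0 ?leq_addl.
Qed.

Lemma line_growthM d e u v : line_growth d u -> line_growth e v ->
  line_growth (d + e) (fun t => u t * v t).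
Proof.
move=> [A [K [A0 uA]]] [B [L [B0 vB]]]; exists (A * B), (K + L)%N.
split=> [|t]; first exact: mulr_ge0.
rewrite cabsM !exprD [leRHS](_ : _ = (A * (1 + cabs t) ^+ K * omega t ^+ d) *
  (B * (1 + cabs t) ^+ L * omega t ^+ e)); last by ring.
by rewrite ler_pM ?cabs_ge0.
Qed.

Lemma line_growth_horner (q : {poly C R}) : line_growth 0 (fun t => q.[t]).
Proof.
have [A [K [A0 H]]] := pgrowth_horner q; exists A, K; split=> // t.
by rewrite expr0 mulr1.
Qed.

Lemma line_growthN d u : line_growth d u -> line_growth d (fun t => - u t).
Proof. by move=> [A [K [A0 uA]]]; exists A, K; split=> // t; rewrite cabsN. Qed.

Lemma line_growth_dc d u : holo u -> line_growth d u -> line_growth d (dc u).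
Proof.
move=> uh [A [K [A0 uA]]]; exists (2 * A * 2 ^+ K * expR 1 ^+ d), K.
split=> [|t]; first by rewrite !mulr_ge0 ?exprn_ge0 ?expR_ge0.
have := @cauchy_estimate _ _ _ (fun x => dcP x uh) t 1
  (A * (2 ^+ K * (1 + cabs t) ^+ K) * (expR 1 ^+ d * omega t ^+ d)) ltr01.
rewrite divr1 => H.
have -> : 2 * A * 2 ^+ K * expR 1 ^+ d * (1 + cabs t) ^+ K * omega t ^+ d =
  2 * (A * (2 ^+ K * (1 + cabs t) ^+ K) * (expR 1 ^+ d * omega t ^+ d)) by ring.
apply: H => w w1; have o0 x : 0 <= omega x by exact: le_trans (omega_ge1 x).
have t0 := cabs_ge0 t.
rewrite (le_trans (uA _))// ler_pM ?mulr_ge0 ?exprn_ge0 ?addr_ge0 ?cabs_ge0//.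
  rewrite ler_wpM2l// -exprMn lerXn2r ?nnegrE ?mulr_ge0 ?addr_ge0 ?cabs_ge0//.
  by have := ler_cabsD t w; lra.
by rewrite -exprMn lerXn2r ?nnegrE ?mulr_ge0 ?expR_ge0 ?omega_shift.
Qed.

End LineGrowth.

(** * Vanishing of the lower-order term on a line *)

Section LineVanishing.
Context {R : realType}.
Variables (N : nat) (u w : C R -> C R) (P : {poly C R}).
Let n := N.+2.
Hypotheses (uh : holo u) (wh : holo w) (P0 : P.[0] != 0).
Hypothesis uw : forall t, u t ^+ n + w t = P.[t] * cexp t.
Hypotheses (ug : line_growth n 1 u) (wg : line_growth n N w).

Let dP := (P^`() + P)%R.

(** phi / (P u) is the logarithmic derivative of u^n / (P e^t), with denominators cleared; psi is,
    up to sign, the analogous expression for w / (P e^t). *)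
Let phi t := n%:R * (P.[t] * dc u t) - dP.[t] * u t.

Let psi t := dP.[t] * w t - P.[t] * dc w t.

(** Elimination of e^t between the equation and its derivative. *)
Lemma phi_psi t : u t ^+ N.+1 * phi t = psi t.
Proof.
have D1 : cder (fun t => u t ^+ n + w t) t (n%:R * u t ^+ N.+1 * dc u t + dc w t).
  by apply: cderD; [apply: cderX|]; exact: dcP.
have D2 : cder (fun t => u t ^+ n + w t) t (P.[t] * cexp t + cexp t * (P^`()).[t]).
  apply: cder_eq (cderM (cder_horner P t) (cder_cexp t)) => [s|]; first by rewrite uw.
  by [].
have := cder_uniq D1 D2 => /eqP; rewrite addrC -subr_eq => /eqP D.
have U : u t ^+ n = P.[t] * cexp t - w t by rewrite -uw addrK.
have -> : u t ^+ N.+1 * phi t =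
   P.[t] * (n%:R * u t ^+ N.+1 * dc u t) - dP.[t] * u t ^+ n.
  by rewrite /phi /n [u t ^+ N.+2]exprSr; ring.
rewrite U /psi /dP hornerD.
have -> : n%:R * u t ^+ N.+1 * dc u t = P.[t] * cexp t + cexp t * (P^`()).[t] - dc w t.
  by rewrite -D; ring.
by ring.
Qed.

Lemma phi_holo : holo phi.
Proof.
apply: holoB; last by apply: holoM => //; exact: holo_horner.
apply: (@holoM _ (fun=> n%:R)); first exact: (fun t => ex_intro _ _ (cder_cst _ t)).
by apply: holoM; [exact: holo_horner|exact: holo_dc].
Qed.

Lemma phi_growth : line_growth n 1 phi.
Proof.
apply: line_growthD.
  have -> : (fun t => n%:R * (P.[t] * dc u t)) = (fun t => (n%:R%:P * P).[t] * dc u t).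
    by apply/funext => t; rewrite hornerM hornerC mulrA.
  apply: (line_growthM (d := 0)); first exact: line_growth_horner.
  exact: line_growth_dc.
apply: line_growthN; apply: (line_growthM (d := 0)) => //.
exact: line_growth_horner.
Qed.

Lemma psi_growth : line_growth n N psi.
Proof.
apply: line_growthD.
  apply: (line_growthM (d := 0)) => //; exact: line_growth_horner.
apply: line_growthN; apply: (line_growthM (d := 0)); first exact: line_growth_horner.
exact: line_growth_dc.
Qed.

(* Where the weight dominates, |u|^n is comparable to the exponential. *)
Lemma phi_large : exists (A T : R) (K : nat), 0 <= A /\ forall t, T <= cabs t ->
  A * (1 + cabs t) ^+ K <= omega n t ^+ 2 -> 0 <= complex.Re t ->
  cabs (phi t) * omega n t <= A * (1 + cabs t) ^+ K.
Proof.
have PN0 : P != 0 by apply: contraNneq P0 => ->; rewrite horner0.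
have [c [T [c0 cT]]] := poly_large PN0.
have [A1 [K1 [A10 uA]]] := ug; have [A2 [K2 [A20 sA]]] := psi_growth.
have [A4 [K4 [A40 wA]]] := wg.
(* The share A4 lets the condition on omega force |w| below half of the lower bound c * omega ^+ n
   for |P e^t|; the share A2 * A1 is the bound that results for phi. *)
exists (2 / c * (A4 + A2 * A1)), T, (K4 + (K2 + K1))%N; split=> [|t tT oP Rt].
  by rewrite mulr_ge0 ?divr_ge0 ?addr_ge0 ?mulr_ge0// ltW.
set S := 1 + cabs t in oP *; set o := omega n t in oP *.
have S1 : 1 <= S by rewrite lerDl cabs_ge0.
have S0 : 0 <= S by exact: le_trans S1.
have o1 : 1 <= o by exact: omega_ge1.
have o0 : 0 < o by exact: lt_le_trans o1.
have on : o ^+ n = expR (complex.Re t).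
  rewrite /o /omega -expRM_natl mulrC divfK ?pnatr_eq0//.
  by congr expR; apply/max_idPr.
have wS : cabs (w t) <= c / 2 * o ^+ n.
  have Y : A4 * S ^+ K4 <= c / 2 * o ^+ 2.
    apply: (@le_trans _ _ (c / 2 * (2 / c * (A4 + A2 * A1) * S ^+ (K4 + (K2 + K1))))).
      rewrite (_ : c / 2 * _ = (A4 + A2 * A1) * S ^+ (K4 + (K2 + K1))); last first.
        by field; rewrite gt_eqF.
      rewrite ler_pM ?exprn_ge0//; first by rewrite lerDl mulr_ge0.
      by rewrite ler_weXn2l// leq_addr.
    by rewrite ler_wpM2l// divr_ge0// ltW.
  rewrite (le_trans (wA t))// (_ : c / 2 * o ^+ n = c / 2 * o ^+ 2 * o ^+ N); last first.
    by rewrite /n -(addn2 N) exprD; ring.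
  by rewrite ler_wpM2r ?exprn_ge0// ltW.
have un : c / 2 * o ^+ n <= cabs (u t) ^+ n.
  have : c * o ^+ n <= cabs (u t) ^+ n + cabs (w t).
    rewrite -cabsX (le_trans _ (ler_cabsD _ _))// uw cabsM cabs_cexp on.
    by rewrite ler_wpM2r ?expR_ge0 ?cT.
  by move: wS; lra.
have H : cabs (phi t) * (c / 2 * o ^+ n) <= A2 * A1 * S ^+ (K2 + K1) * o ^+ N.+1.
  apply: (@le_trans _ _ (cabs (phi t) * cabs (u t) ^+ n)).
    by rewrite ler_wpM2l ?cabs_ge0.
  (* Only |u|^n has a lower bound. Multiplying [phi_psi] once more by u avoids extracting a root:
     omega^n stands on the left against omega^(n-1) on the right. *)
  have -> : cabs (phi t) * cabs (u t) ^+ n = cabs (u t) * cabs (psi t).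
    by rewrite -phi_psi cabsM cabsX /n [X in _ * X]exprS; ring.
  have -> : A2 * A1 * S ^+ (K2 + K1) * o ^+ N.+1 =
     (A1 * S ^+ K1 * o ^+ 1) * (A2 * S ^+ K2 * o ^+ N).
    by rewrite exprD exprS expr1; ring.
  by rewrite ler_pM ?cabs_ge0 ?uA ?sA.
have H' : cabs (phi t) * o <= 2 / c * (A2 * A1 * S ^+ (K2 + K1)).
  rewrite -(ler_pM2r (exprn_gt0 N.+1 o0)) -(ler_pM2l (_ : 0 < c / 2)) ?divr_gt0//.
  have -> : c / 2 * (cabs (phi t) * o * o ^+ N.+1) = cabs (phi t) * (c / 2 * o ^+ n).
    by rewrite /n [in RHS]exprS; ring.
  apply: le_trans H _; rewrite le_eqVlt; apply/orP; left; apply/eqP.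
  by field; rewrite gt_eqF.
rewrite (le_trans H')// -!mulrA ler_wpM2l ?invr_ge0// ler_wpM2l ?invr_ge0 ?(ltW c0)// !mulrA.
rewrite ler_pM ?mulr_ge0 ?exprn_ge0//; first by rewrite lerDr.
by rewrite ler_weXn2l// leq_addl.
Qed.

(** Where [phi_large] does not apply, t lies in a compact disc or omega itself is polynomially
    bounded, and then [phi_growth] is enough for Liouville's theorem. *)
Lemma phi_poly : exists q : {poly C R}, forall t, phi t = q.[t].
Proof.
have [A [T [K [A0 H]]]] := phi_large.
have [A1 [K1 [A10 H1]]] := phi_growth.
have [M MP] := holo_bound T phi_holo.
pose B := `|M| + (A + A1 + A1 * A).
have B0 : 0 <= A1 * A by rewrite mulr_ge0.
suff HB t : cabs (phi t) <= B * (1 + cabs t) ^+ (K + K1).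
  by have [q _ qP] := liouville phi_holo HB; exists q.
set S := 1 + cabs t.
have S1 : 1 <= S by rewrite lerDl cabs_ge0.
have S0 : 0 <= S by exact: le_trans S1.
have SK k : (k <= K + K1)%N -> S ^+ k <= S ^+ (K + K1) by move=> kK; rewrite ler_weXn2l.
have o1 := omega_ge1 n t.
have o0 : 0 <= omega n t by exact: le_trans o1.
have final A' k : 0 <= A' -> A' <= B -> (k <= K + K1)%N -> A' * S ^+ k <= B * S ^+ (K + K1).
  by move=> A'0 A'B kK; rewrite ler_pM ?exprn_ge0 ?SK.
have nM := normr_ge0 M.
have [tT|tT] := leP (cabs t) T.
  rewrite (le_trans (MP t tT))// (le_trans (ler_norm _))// -[leLHS]mulr1 -(expr0 S).
  by rewrite final// /B lerDl !addr_ge0.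
have phi1 : cabs (phi t) <= A1 * S ^+ K1 * omega n t by have := H1 t; rewrite expr1.
have [Rt|Rt] := leP 0 (complex.Re t); last first.
  have o_1 : omega n t = 1.
    rewrite /omega (_ : Num.max _ _ = 0) ?mul0r ?expR0//.
    by apply/max_idPl; exact: ltW.
  move: phi1; rewrite o_1 mulr1 => /le_trans; apply; apply: final => //.
    by rewrite /B; lra.
  exact: leq_addl.
have [oP|oP] := leP (A * S ^+ K) (omega n t ^+ 2).
  apply: (@le_trans _ _ (cabs (phi t) * omega n t)); first by rewrite ler_peMr ?cabs_ge0.
  rewrite (le_trans (H t (ltW tT) oP Rt))//; apply: final => //.
    by rewrite /B; lra.
  exact: leq_addr.
apply: (@le_trans _ _ (A1 * A * S ^+ (K + K1))); last first.
  by apply: final => //; rewrite /B; lra.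
have -> : A1 * A * S ^+ (K + K1) = A1 * S ^+ K1 * (A * S ^+ K) by rewrite exprD; ring.
rewrite (le_trans phi1)// ler_wpM2l ?mulr_ge0 ?exprn_ge0//.
by rewrite (le_trans _ (ltW oP))// expr2 ler_peMr.
Qed.

Lemma phi0 t : phi t = 0.
Proof.
have [q qP] := phi_poly.
have [q0|q0] := eqVneq q 0; first by rewrite qP q0 horner0.
exfalso.
have [c [T1 [c0 cT]]] := poly_large q0.
have [A [T [K [A0 H]]]] := phi_large.
(* Beyond x1 the point x is in the range of [phi_large]; beyond x2 the bound obtained there is at
   most c / 2, against the lower bound c for a nonzero polynomial. *)
have [x1 [x10 x1P]] := @exp_decay R A K n 1 isT ltr01.
have [x2 [x20 x2P]] := @exp_decay R A K n (c / 2) isT ltac:(by rewrite divr_gt0).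
pose x := `|T1| + `|T| + x1 + x2.
have x0 : 0 <= x by rewrite !addr_ge0.
have nT := normr_ge0 T; have nT1 := normr_ge0 T1; have lT := ler_norm T; have lT1 := ler_norm T1.
have cx : cabs (real_complex R x) = x by rewrite cabs_real ger0_norm.
have ox : omega n (real_complex R x) = expR (x / n%:R).
  rewrite /omega (_ : Num.max 0 (complex.Re (real_complex R x)) = x)//.
  exact/max_idPr.
have e1 : 1 <= expR (x / n%:R) by rewrite -expR0 ler_expR divr_ge0.
have := x1P x; rewrite expRN ler_pdivrMr ?expR_gt0// mul1r => Hx1.
have := H (real_complex R x); rewrite cx ox => /(_ _)/(_ _)/(_ x0) Hx.
have : cabs (phi (real_complex R x)) <= c / 2.
  have := x2P x; rewrite expRN => Hx2; apply: le_trans (Hx2 _); last by rewrite /x; lra.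
  rewrite ler_pdivlMr ?expR_gt0//; apply: Hx; first by rewrite /x; lra.
  apply: le_trans (Hx1 _) _; first by rewrite /x; lra.
  by rewrite expr2 ler_peMr ?expR_ge0.
have := cT (real_complex R x); rewrite -qP cx => /(_ _) Hc.
have : c <= cabs (phi (real_complex R x)) by apply: Hc; rewrite /x; lra.
by lra.
Qed.

Theorem line_vanishing : w 0 = 0.
Proof.
have PN0 : P != 0 by apply: contraNneq P0 => ->; rewrite horner0.
have wd t : dP.[t] * w t = P.[t] * dc w t.
  by apply/eqP; rewrite -subr_eq0 -/(psi t) -phi_psi phi0 mulr0.
have [rs PE] := closed_field_poly_normal P.
(* A slope larger than Im r / Re r for every root r: the ray of the points s * tau with s >= 0
   avoids the zeros of P. As Re tau = 1, the exponential decays along it. *)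
pose eta := 1 + \sum_(r <- rs) `|complex.Im r / complex.Re r|.
pose tau : C R := Complex 1 eta.
have Pray (s : R) : 0 <= s -> P.[real_complex R s * tau] != 0.
  move=> s0; have [->|sN0] := eqVneq s 0; first by rewrite rmorph0 mul0r.
  apply/eqP => /eqP; rewrite PE hornerZ mulf_eq0 lead_coef_eq0 (negPf PN0) /=.
  rewrite -/(root _ _) root_prod_XsubC => rrs.
  set r := _ * tau in rrs.
  have Rr : complex.Re r = s by rewrite /r /tau /= mul0r subr0 mulr1.
  have Ir : complex.Im r = s * eta by rewrite /r /tau /= mul0r addr0.
  clearbody r.
  have : eta <= \sum_(r <- rs) `|complex.Im r / complex.Re r|.
    rewrite (big_rem r)//= Rr Ir mulrC mulKf// ler_wpDr ?ler_norm//.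
    by rewrite sumr_ge0.
  by rewrite /eta; lra.
pose h t := w t * cexp (0 - t) / P.[t].
have hd (s : R) : 0 <= s -> cder h (real_complex R s * tau) 0.
  move=> s0; set t := _ * tau.
  have := cderM (cderM (dcP t wh)
    (cder_comp (cderB (cder_cst 0 t) (cder_id t)) (cder_cexp (0 - t))))
    (cderV (Pray s s0) (cder_horner P t)).
  apply: cder_eq => //=.
  have := wd t; rewrite /dP hornerD => E.
  have pt := Pray s s0; rewrite -/t in pt.
  have -> : dc w t = ((P^`()).[t] + P.[t]) * w t / P.[t].
    by rewrite E mulrAC divff// mul1r.
  by field.
have hc (s : R) : 0 <= s -> h (real_complex R s * tau) = h 0.
  move=> s0; apply/eqP; rewrite -subr_eq0 -cabs_eq0 eq_le cabs_ge0 andbT.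
  rewrite -[leRHS](mul0r (cabs (real_complex R s * tau - 0))).
  apply: mean_value_bound => x /andP[x0 _]; exists 0; last by rewrite cabs0.
  by rewrite add0r subr0 mulrA -rmorphM; apply: hd; rewrite mulr_ge0.
suff : h 0 = 0.
  rewrite /h subr0 cexp0 mulr1 => /eqP; rewrite mulf_eq0 invr_eq0 (negPf P0) orbF.
  by move/eqP.
apply/eqP; rewrite -cabs_eq0 eq_le cabs_ge0 andbT.
apply/ler_addgt0Pr => e e0; rewrite add0r.
have [c [T [c0 cT]]] := poly_large PN0.
have [A [K [A0 wA]]] := wg.
have tau1 : 1 <= cabs tau.
  by rewrite (le_trans _ (normr_Re_le _))//= normr1.
have tau0 : 0 <= cabs tau by exact: le_trans tau1.
have [x0 [x00 x0P]] := @exp_decay R (A * cabs tau ^+ K / c) K n e isT e0.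
pose x := x0 + `|T|.
have xx : 0 <= x by rewrite addr_ge0.
have cx : cabs (real_complex R x * tau) = x * cabs tau.
  by rewrite cabsM cabs_real ger0_norm.
rewrite -(hc x xx); apply: le_trans (x0P x _); last by rewrite lerDl.
have Rx : complex.Re (real_complex R x * tau) = x by rewrite /tau /= mul0r subr0 mulr1.
have Rx' : complex.Re (- (real_complex R x * tau)) = - x.
  by rewrite /tau /= mul0r subr0 mulr1.
rewrite /h !cabsM cabsV cabs_cexp sub0r Rx'.
have -> : A * cabs tau ^+ K / c * (1 + x) ^+ K * expR (- (x / n%:R)) =
   A * (cabs tau * (1 + x)) ^+ K * expR (- (x / n%:R)) / c.
  by rewrite exprMn; ring.
have ex : expR (x / n%:R) ^+ N * expR (- x) <= expR (- (x / n%:R)).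
  rewrite -expRM_natl -expRD ler_expR.
  (* Since n = N.+2, e^(N x / n) against e^(- x) leaves e^(- 2 x / n), of which e^(- x / n) is kept
     to match [exp_decay]. *)
  have -> : - (x / n%:R) = N.+1%:R * (x / n%:R) - x.
    have xE : x = n%:R * (x / n%:R) by rewrite mulrC divfK ?pnatr_eq0.
    by rewrite [X in _ = _ - X]xE; move: (x / _) => y; rewrite /n -[N.+2%:R]natr1; ring.
  by rewrite lerD2r ler_wpM2r ?divr_ge0// ler_nat.
apply: ler_pM; rewrite ?mulr_ge0 ?cabs_ge0 ?expR_ge0 ?invr_ge0 ?cabs_ge0//; last first.
  rewrite lef_pV2 ?posrE ?cabs_gt0 ?Pray//; apply: cT; rewrite cx.
  apply: (@le_trans _ _ (x * 1)); last by rewrite ler_wpM2l.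
  by rewrite mulr1 /x; have := ler_norm T; lra.
apply: (@le_trans _ _ (A * (cabs tau * (1 + x)) ^+ K * (expR (x / n%:R) ^+ N * expR (- x)))); last first.
  by rewrite ler_wpM2l// mulr_ge0 ?exprn_ge0 ?mulr_ge0 ?addr_ge0.
rewrite mulrA ler_wpM2r ?expR_ge0//; apply: le_trans (wA _) _.
have -> : omega n (real_complex R x * tau) = expR (x / n%:R).
  by rewrite /omega Rx (_ : Num.max 0 x = x)//; exact/max_idPr.
rewrite ler_wpM2r ?exprn_ge0 ?expR_ge0// ler_wpM2l// lerXn2r ?nnegrE ?addr_ge0 ?cabs_ge0//.
  by rewrite mulr_ge0// addr_ge0.
by rewrite cx mulrDr mulr1 [x * _]mulrC lerD2r.
Qed.

End LineVanishing.

(** * Form of the solutions *)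

Lemma ler_affine_prod (R : realDomainType) (x y s : R) : 0 <= x -> 0 <= y -> 0 <= s ->
  1 + (x + s * y) <= (1 + x) * (1 + y) * (1 + s).
Proof.
move=> x0 y0 s0; rewrite -subr_ge0.
rewrite (_ : _ - _ = y + x * y + s + x * s + x * y * s); last by ring.
by rewrite !addr_ge0 ?mulr_ge0.
Qed.

Section PolynomialLiouville.
Context {R : realType}.

(** The basis polynomials depend on K alone, so when q is a slice of g the other variables enter
    only through the sampled values. *)
Lemma lagrange_interpolation (K : nat) : exists l : 'I_K.+1 -> {poly C R},
  forall q : {poly C R}, (size q <= K.+1)%N ->
  forall t, q.[t] = \sum_(j < K.+1) q.[j%:R] * (l j).[t].
Proof.
have inj : injective (fun i : nat => i%:R : C R).
  by move=> i j /eqP; rewrite eqr_nat => /eqP.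
exists (fun j => tnth (lagrange K.+1 (fun i : nat => i%:R : C R)) j).
move=> q qs t; rewrite {1}(lagrange_gen (ltn0Sn K) inj qs) horner_sum.
by apply: eq_bigr => j _; rewrite hornerM hornerC.
Qed.

Context {m : nat}.

Lemma peval_horner (q : {poly C R}) (i : 'I_m) :
  exists p : cpoly R m, forall z, peval p z = q.[z 0 i].
Proof.
elim/poly_ind: q => [|q c [p pP]].
  by exists 0 => z; rewrite peval0 horner0.
exists (p * mpoly.mpolyX _ (mpoly.mnm1 i) + mpoly.mpolyC m c) => z.
by rewrite pevalD pevalM pevalXU pevalC hornerMXaddC pP.
Qed.

Lemma peval_sum (I : Type) (s : seq I) (p : I -> cpoly R m) z :
  peval (\sum_(i <- s) p i) z = \sum_(i <- s) peval (p i) z.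
Proof. exact: (big_morph (fun p => peval p z) (fun p q => pevalD p q z) (peval0 z)). Qed.

Lemma peval_prod (I : Type) (s : seq I) (p : I -> cpoly R m) z :
  peval (\prod_(i <- s) p i) z = \prod_(i <- s) peval (p i) z.
Proof.
apply: (big_morph (fun p => peval p z) (fun p q => pevalM p q z)).
by rewrite -[1](expr0 (0 : cpoly R m)) pevalXn expr0.
Qed.

Let update (c : 'rV[C R]_m) (i : 'I_m) (t : C R) : 'rV[C R]_m :=
  \row_k (if k == i then t else c 0 k).

Let merge (k : nat) (z c : 'rV[C R]_m) : 'rV[C R]_m :=
  \row_i (if (i < k)%N then z 0 i else c 0 i).

(* Interpolating on {0, ..., K} in one coordinate after the other. *)
Theorem liouville_several (g : 'rV[C R]_m -> C R) (A : R) (K : nat) :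
  (forall z k, holo (fun t => g (z + t *: delta_mx 0 k))) -> 0 <= A ->
  (forall z, cabs (g z) <= A * (1 + vsize z) ^+ K) ->
  exists q : cpoly R m, forall z, g z = peval q z.
Proof.
move=> gh A0 gA; have [l lP] := lagrange_interpolation K.
have slice c i t : g (update c i t) = \sum_(j < K.+1) g (update c i j%:R) * (l j).[t].
  have upE s : update c i s = update c i 0 + s *: delta_mx 0 i.
    apply/rowP => k; rewrite !mxE eqxx /=; case: eqP => _.
      by rewrite mulr1 add0r.
    by rewrite mulr0 addr0.
  pose c0 := update c i 0.
  have [q qs qE] : exists2 q : {poly C R}, (size q <= K.+1)%N &
      forall s, g (update c i s) = q.[s].
    have [q qs qE] : exists2 q : {poly C R}, (size q <= K.+1)%N &
      forall s, g (c0 + s *: delta_mx 0 i) = q.[s].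
      apply: (@liouville _ K (A * ((1 + vsize c0) * (1 + vsize (delta_mx 0 i : 'rV[C R]_m))) ^+ K)) => //.
      move=> s; rewrite (le_trans (gA _))// -mulrA ler_wpM2l// -exprMn.
      have v1 := vsize_ge0 c0; have v2 := vsize_ge0 (delta_mx 0 i : 'rV[C R]_m).
      have s0 := cabs_ge0 s; have H := vsizeD c0 (s *: delta_mx 0 i).
      rewrite lerXn2r ?nnegrE ?mulr_ge0 ?addr_ge0 ?vsize_ge0//.
      rewrite vsizeZ in H; apply: le_trans (_ : 1 + (vsize c0 + cabs s * vsize (delta_mx 0 i : 'rV[C R]_m)) <= _); first by rewrite lerD2l.
      exact: ler_affine_prod.
    by exists q => // s; rewrite upE qE.
  by rewrite qE (lP q qs); apply: eq_bigr => j _; rewrite qE.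
(* g is polynomial in its first k coordinates for every value c of the others; in the next
   coordinate it is recovered from its values at the nodes 0, ..., K, to which the induction
   hypothesis applies. *)
have main k : (k <= m)%N -> forall c, exists q : cpoly R m,
    forall z, g (merge k z c) = peval q z.
  elim: k => [_ c|k IH km c].
    exists (mpoly.mpolyC m (g c)) => z; rewrite pevalC; congr g.
    by apply/rowP => i; rewrite mxE ltn0.
  pose i0 : 'I_m := Ordinal km.
  have [q qP] := choice (fun j : 'I_K.+1 => IH (ltnW km) (update c i0 j%:R)).
  have [lq lqP] := choice (fun j : 'I_K.+1 => peval_horner (l j) i0).
  exists (\sum_j q j * lq j) => z; rewrite peval_sum.
  have E t : merge k z (update c i0 t) = update (merge k z c) i0 t.
    apply/rowP => i; rewrite !mxE; case: ltnP => // ik; case: eqP => // ii.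
    by rewrite ii ltnn in ik.
  have -> : merge k.+1 z c = update (merge k z c) i0 (z 0 i0).
    apply/rowP => i; rewrite !mxE ltnS leq_eqVlt.
    have [->|ii] := eqVneq i i0; first by rewrite eqxx.
    by rewrite (_ : (i : nat) == k = false)//; apply: contra_neqF ii => /eqP ik; apply/val_inj.
  rewrite slice; apply: eq_bigr => j _.
  by rewrite -E qP pevalM lqP.
have [q qP] := main m (leqnn m) 0; exists q => z; rewrite -qP; congr g.
by apply/rowP => i; rewrite mxE ltn_ord.
Qed.

End PolynomialLiouville.

(** * Solutions are polynomials times an exponential *)

Section Forward.
Context {R : realType} {m : nat}.
Variables (N : nat) (f : 'rV[C R]_m -> C R) (P : diffpoly R m) (p : cpoly R m)
  (alpha : 'rV[C R]_m).
Let n := N.+2.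
Hypotheses (degP : (dp_deg P <= N)%N) (p0 : p != 0) (alpha0 : alpha != 0).
Hypothesis fe : entire f.
Hypothesis eqf : forall z, f z ^+ n + dp_eval P f z = peval p z * cexp (pairing alpha z).
Implicit Types (z a b : 'rV[C R]_m).

Lemma direction_ex (beta : 'rV[C R]_m) : beta != 0 -> exists b, pairing beta b = 1.
Proof.
move=> /rV0Pn[k bk]; exists ((beta 0 k)^-1 *: delta_mx 0 k).
rewrite pairingZ /pairing (bigD1 k)//= big1 ?addr0 => [|j jk].
  by rewrite mxE !eqxx mulr1 mulVf.
by rewrite mxE eqxx (negPf jk) mulr0.
Qed.

(** By continuity w would be nonzero at all the points t + r / k.+1, and these are too many to be
    roots of q. *)
Lemma dense_vanish (w : C R -> C R) (q : {poly C R}) : holo w -> q != 0 ->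
  (forall t, q.[t] != 0 -> w t = 0) -> forall t, w t = 0.
Proof.
move=> wh q0 wq t; apply/eqP; apply: contraT => wt.
have w2 : 0 < cabs (w t) / 2 by rewrite divr_gt0// cabs_gt0.
have [r r0 rP] := cder_continuous (dcP t wh) w2.
pose x (k : nat) : C R := t + real_complex R (r / k.+1%:R).
have xI : injective x.
  move=> i j /addrI /complexI /(mulfI (lt0r_neq0 r0)) /invr_inj /eqP.
  by rewrite eqr_nat => /eqP[].
have xr k : root q (x k).
  apply: contraT => /wq wx.
  have := rP (real_complex R (r / k.+1%:R)).
  rewrite cabs_real ger0_norm ?divr_ge0 ?(ltW r0)// ler_pdivrMr// ler_peMr ?(ltW r0) ?ler1n// => /(_ isT).
  rewrite -/(x k) wx sub0r cabsN.
  by have := w2; lra.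
have /= := @max_poly_roots _ q [seq x k | k <- iota 0 (size q)] q0.
rewrite map_inj_uniq ?iota_uniq// size_map size_iota ltnn => H.
have /H/(_ isT) // : all (root q) [seq x k | k <- iota 0 (size q)].
by apply/allP => _ /mapP[k _ ->].
Qed.

Lemma vsize_line a b t : 1 + vsize (a + t *: b) <= (1 + vsize a) * (1 + vsize b) * (1 + cabs t).
Proof.
have v1 := vsize_ge0 a; have v2 := vsize_ge0 b; have s0 := cabs_ge0 t.
have H := vsizeD a (t *: b); rewrite vsizeZ in H.
apply: (@le_trans _ _ (1 + (vsize a + cabs t * vsize b))); first by rewrite lerD2l.
exact: ler_affine_prod.
Qed.

Lemma weight_line a b t : pairing alpha b = 1 ->
  weight n alpha (a + t *: b) <= weight n alpha a * omega n t.
Proof.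
move=> ab; rewrite /weight /omega -expRD ler_expR -mulrDl ler_wpM2r ?invr_ge0//.
rewrite pairingD pairingZ ab mulr1 raddfD /= ge_max lerD ?le_max ?lexx ?orbT// andbT.
by rewrite addr_ge0// le_max lexx.
Qed.

Lemma line_growth_of (A : R) (K d : nat) (g : 'rV[C R]_m -> C R) a b :
  0 <= A -> pairing alpha b = 1 ->
  (forall z, cabs (g z) <= A * (1 + vsize z) ^+ K * weight n alpha z ^+ d) ->
  line_growth n d (fun t => g (a + t *: b)).
Proof.
move=> A0 ab gA.
exists (A * ((1 + vsize a) * (1 + vsize b)) ^+ K * weight n alpha a ^+ d), K.
have va := vsize_ge0 a; have vb := vsize_ge0 b.
have w0 z : 0 <= weight n alpha z by exact: expR_ge0.
have o0 (t : C R) : 0 <= omega n t by exact: expR_ge0.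
split=> [|t]; first by rewrite !mulr_ge0 ?exprn_ge0 ?mulr_ge0 ?addr_ge0.
rewrite (le_trans (gA _))//.
rewrite [leRHS](_ : _ = A * ((1 + vsize a) * (1 + vsize b) * (1 + cabs t)) ^+ K *
   (weight n alpha a * omega n t) ^+ d); last by rewrite !exprMn; ring.
rewrite ler_pM ?mulr_ge0 ?exprn_ge0 ?addr_ge0 ?vsize_ge0//.
  rewrite ler_wpM2l// lerXn2r ?nnegrE ?mulr_ge0 ?addr_ge0 ?vsize_ge0 ?cabs_ge0//.
  exact: vsize_line.
apply: lerXn2r; rewrite ?nnegrE ?mulr_ge0//; exact: weight_line.
Qed.

Lemma weight_shift_le z v : polydisc 1 v ->
  weight n alpha (z + v) <= expR (vsize alpha) * weight n alpha z.
Proof.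
move=> v1; rewrite /weight -expRD ler_expR.
have n1 : 1 <= n%:R :> R by rewrite ler1n.
have n0 : 0 < n%:R :> R by exact: lt_le_trans n1.
rewrite ler_pdivrMr// mulrDl divfK ?gt_eqF//.
have va := vsize_ge0 alpha.
have H : complex.Re (pairing alpha v) <= vsize alpha * n%:R.
  rewrite (le_trans (ler_norm _))// (le_trans (normr_Re_le _))//.
  by rewrite (le_trans (cabs_pairing alpha v1))// ler_wpM2l.
rewrite pairingD raddfD /= ge_max addrC lerD//= ?le_max ?lexx ?orbT// andbT.
by rewrite addr_ge0 ?mulr_ge0// le_max lexx.
Qed.

(** Applies [line_vanishing] on the line through a in a direction b on which alpha has value 1; p a
    != 0 is its hypothesis that the polynomial does not vanish at 0. *)
Lemma dp_eval0_nz a : peval p a != 0 -> dp_eval P f a = 0.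
Proof.
move=> pa; have fs := entire_sepholo fe.
have [A [K [A0 fA]]] := growth fs
  (diff_bounded_dp_eval fs (leq_trans degP (leqnSn N))) eqf.
have [B [L [e [B0 WB]]]] := diff_bounded_dp_eval fs degP.
(* [diff_bounded] wants a local bound M >= 1, and A may be smaller than 1. *)
pose A' := A + 1.
have A'1 : 1 <= A' by rewrite lerDr.
have A'0 : 0 <= A' by exact: le_trans A'1.
pose v1 : R := 1 + m%:R.
have v11 : 1 <= v1 by rewrite lerDl.
have v10 : 0 <= v1 by exact: le_trans v11.
have ea : 1 <= expR (vsize alpha) by rewrite -expR0 ler_expR vsize_ge0.
have Wgrowth z : cabs (dp_eval P f z) <=
    B * (A' * v1 ^+ K * expR (vsize alpha)) ^+ N * (1 + vsize z) ^+ (L + K * N) * weight n alpha z ^+ N.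
  have vz := vsize_ge0 z.
  pose M := A' * (v1 * (1 + vsize z)) ^+ K * (expR (vsize alpha) * weight n alpha z).
  have M1 : 1 <= M.
    apply: mulr_ege1; apply: mulr_ege1 => //; last exact: weight_ge1.
    by apply: exprn_ege1; apply: mulr_ege1; rewrite ?lerDl.
  have fM v : polydisc 1 v -> cabs (f (z + v)) <= M.
    move=> vv; rewrite (le_trans (fA _))// /M ler_pM ?mulr_ge0 ?exprn_ge0 ?addr_ge0 ?vsize_ge0 ?expR_ge0//.
      rewrite ler_pM ?exprn_ge0 ?addr_ge0 ?vsize_ge0//; first by rewrite lerDl.
      rewrite lerXn2r ?nnegrE ?mulr_ge0 ?addr_ge0 ?vsize_ge0//.
      have vm := vsize_polydisc vv; rewrite mulr1 in vm.
      apply: (@le_trans _ _ (1 + (vsize z + m%:R))).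
        by rewrite lerD2l (le_trans (vsizeD z v))// lerD2l.
      rewrite -subr_ge0 (_ : _ - _ = m%:R * vsize z); last by rewrite /v1; ring.
      by rewrite mulr_ge0.
    exact: weight_shift_le.
  have := WB z 1 M ltr01 (lexx 1) M1 fM; rewrite expr1n invr1 mulr1.
  rewrite /M => /le_trans; apply; rewrite le_eqVlt; apply/orP; left; apply/eqP.
  by rewrite !exprMn exprD exprM; ring.
have [b ab] := direction_ex alpha0.
have [q qP] := peval_line p a b.
have q00 : (cexp (pairing alpha a) *: q).[0] != 0.
  by rewrite hornerZ -qP scale0r addr0 mulf_neq0// cexp_neq0.
have eqt t : f (a + t *: b) ^+ n + dp_eval P f (a + t *: b) =
    (cexp (pairing alpha a) *: q).[t] * cexp t.
  rewrite eqf hornerZ -qP pairingD pairingZ ab mulr1 cexpD.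
  by rewrite mulrA [cexp _ * peval _ _]mulrC.
have uh := entire_line a b fe.
(* Holomorphy of P_d(f) on the line is read off the equation, without differentiating P_d(f)
   itself. *)
have wh : holo (fun t => dp_eval P f (a + t *: b)).
  have -> : (fun t => dp_eval P f (a + t *: b)) =
     (fun t => (cexp (pairing alpha a) *: q).[t] * cexp t - f (a + t *: b) ^+ n).
    by apply/funext => t; rewrite -eqt addrAC subrr add0r.
  apply: holoB; last exact: holoX.
  apply: holoM; first exact: holo_horner.
  by move=> t; exists (cexp t); exact: cder_cexp.
have := line_vanishing uh wh q00 eqt
  (line_growth_of (d := 1) a A0 ab fA) (line_growth_of a _ ab Wgrowth).
rewrite scale0r addr0; apply.
by rewrite mulr_ge0 ?exprn_ge0 ?mulr_ge0 ?exprn_ge0 ?expR_ge0.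
Qed.

(** A zero z of p is joined by a line to a point where p does not vanish; p has finitely many zeros
    on that line, and P_d(f) is holomorphic along it. *)
Theorem forward_dp_eval0 z : dp_eval P f z = 0.
Proof.
have [z0 pz0] := cpoly_neq0_ex p0.
have [q qP] := peval_line p z (z0 - z).
have [l lP] : exists l : {poly C R}, forall t, pairing alpha (z + t *: (z0 - z)) = l.[t].
  exists ((pairing alpha z)%:P + (pairing alpha (z0 - z)) *: 'X) => t.
  by rewrite pairingD pairingZ hornerD hornerC hornerZ hornerX mulrC.
have wh : holo (fun t => dp_eval P f (z + t *: (z0 - z))).
  have -> : (fun t => dp_eval P f (z + t *: (z0 - z))) =
     (fun t => q.[t] * cexp l.[t] - f (z + t *: (z0 - z)) ^+ n).
    by apply/funext => t; rewrite -qP -lP -eqf addrAC subrr add0r.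
  apply: holoB; last by apply: holoX; exact: entire_line.
  apply: holoM; first exact: holo_horner.
  by apply: holo_cexp; exact: holo_horner.
have q0 : q != 0.
  apply: contraNneq pz0 => q0; have := qP 1.
  by rewrite scale1r addrC subrK q0 horner0 => ->.
have wq t : q.[t] != 0 -> dp_eval P f (z + t *: (z0 - z)) = 0.
  by rewrite -qP; exact: dp_eval0_nz.
by have := dense_vanish wh q0 wq 0; rewrite scale0r addr0.
Qed.

Theorem forward_solution : exists q : cpoly R m, q ^+ n = p /\
  forall z, f z = peval q z * cexp (pairing alpha z / n%:R).
Proof.
pose g z := f z * cexp (- (pairing alpha z / n%:R)).
have gn z : g z ^+ n = peval p z.
  rewrite exprMn cexpX mulrN mulrC [n%:R * _]mulrC divfK ?pnatr_eq0//.
  have := eqf z; rewrite forward_dp_eval0 addr0 => ->.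
  by rewrite mulrC -mulrA -cexpD subrr cexp0 mulr1.
have [A [K [A0 pA]]] := pgrowth_peval p.
have [q qP] : exists q : cpoly R m, forall z, g z = peval q z.
  apply: (@liouville_several _ _ g (1 + A) K); last 2 first.
  - exact: addr_ge0.
  - move=> z; have S1 : 1 <= (1 + vsize z) ^+ K by rewrite exprn_ege1// lerDl vsize_ge0.
    (* x <= 1 + x^n turns the polynomial bound of g^n = p into one of g without taking roots. *)
    apply: (@le_trans _ _ (1 + cabs (g z) ^+ n)).
      have [g1|g1] := leP (cabs (g z)) 1.
        by rewrite (le_trans g1)// lerDl exprn_ge0// cabs_ge0.
      rewrite (@le_trans _ _ (cabs (g z) ^+ n))//; last by rewrite lerDr.
      by rewrite -[leLHS]expr1 ler_weXn2l// ltW.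
    by rewrite -cabsX gn mulrDl mul1r lerD.
  - move=> z k; apply: holoM; first exact: entire_line.
    apply: holo_cexp => t.
    exists (- (pairing alpha (delta_mx 0 k) / n%:R)).
    apply: cder_eq (cder_affine (- (pairing alpha z / n%:R)) (- (pairing alpha (delta_mx 0 k) / n%:R)) t) => // s.
    by rewrite pairingD pairingZ; ring.
exists q; split.
  by apply: cpoly_ext => z; rewrite pevalXn -qP gn.
move=> z; by rewrite -qP /g -mulrA -cexpD addNr cexp0 mulr1.
Qed.

End Forward.

(** * Exponential polynomials *)

Section ExponentialSolutions.
Context {R : realType} {m : nat}.
Variables (n : nat) (alpha : 'rV[C R]_m).
Hypotheses (n0 : (0 < n)%N) (alpha0 : alpha != 0).
Implicit Types (z b : 'rV[C R]_m) (q r : cpoly R m) (P : diffpoly R m).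

Let expo z : C R := cexp (pairing alpha z / n%:R).

Let nR0 : n%:R != 0 :> C R.
Proof. by rewrite pnatr_eq0 -lt0n. Qed.

Lemma pairing_peval (beta : 'rV[C R]_m) : exists l, forall z, pairing beta z = peval l z.
Proof.
exists (\sum_k mpoly.mpolyC m (beta 0 k) * mpoly.mpolyX _ (mpoly.mnm1 k)) => z.
by rewrite peval_sum; apply: eq_bigr => k _; rewrite pevalM pevalC pevalXU.
Qed.

Lemma entire_expsol q : entire (fun z => peval q z * expo z).
Proof.
move=> z; have [l lP] := pairing_peval ((n%:R)^-1 *: alpha).
have -> : (fun z => peval q z * expo z) = peval q * (@cexp R \o peval l).
  apply/funext => w; rewrite /expo; congr (_ * cexp _).
  rewrite -lP /pairing mulr_suml; apply: eq_bigr => k _.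
  by rewrite mxE mulrAC [X in X * _]mulrC.
apply: differentiableM; first exact: entire_peval.
apply: differentiable_comp; first exact: entire_peval.
by apply/derivable1_diffP; have /cderP[] := cder_cexp (peval l z).
Qed.

(** Translation by this amount in a direction of slope 1 fixes [expo], while its multiples sample a
    polynomial at infinitely many points of the line: exponential and polynomial factors can thus be
    separated. *)
Let period : C R := n%:R * Complex 0 (pi *+ 2).

Lemma expo_period b z k : pairing alpha b = 1 ->
  expo (z + (k%:R * period) *: b) = expo z.
Proof.
move=> ab; elim: k => [|k IH]; first by rewrite mul0r scale0r addr0.
rewrite -[RHS]IH /expo -(cexp_2pi (pairing alpha (z + (k%:R * period) *: b) / n%:R)).
congr cexp; rewrite !pairingD !pairingZ ab !mulr1 -natr1 /period.
by move: (Complex 0 _) => c; field.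
Qed.

Let period_neq0 : period != 0.
Proof.
by rewrite mulf_neq0// -cabs_gt0 cabs_imag normr_gt0 gt_eqF// mulrn_wgt0 ?pi_gt0.
Qed.

Lemma poly_periodic0 (s : {poly C R}) : (forall k : nat, s.[k%:R * period] = 0) -> s = 0.
Proof.
move=> s0; apply/eqP; apply: contraT => sN0.
have /= := @max_poly_roots _ s [seq k%:R * period | k <- iota 0 (size s)] sN0.
rewrite map_inj_uniq ?iota_uniq ?size_map ?size_iota ?ltnn; last first.
  by move=> i j /(mulIf period_neq0) /eqP; rewrite eqr_nat => /eqP.
move=> H; have /H/(_ isT) // : all (root s) [seq k%:R * period | k <- iota 0 (size s)].
by apply/allP => _ /mapP[k _ ->]; rewrite /root s0.
Qed.

(** If q * expo were a polynomial r, sampling at the periods would give r = expo a * q on the whole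
    line through a. At a real parameter x > 0 with q nonzero this forces expR (x / n) = 1. *)
Lemma transcendental_expsol q : q != 0 -> transcendental (fun z => peval q z * expo z).
Proof.
move=> /cpoly_neq0_ex[a qa] [r rP].
have [b ab] := direction_ex alpha0.
have [q1 q1P] := peval_line q a b; have [r1 r1P] := peval_line r a b.
have q10 : q1 != 0.
  by apply: contraNneq qa => q10; have := q1P 0; rewrite scale0r addr0 q10 horner0 => ->.
have E : r1 = expo a *: q1.
  apply/eqP; rewrite -subr_eq0; apply/eqP; apply: poly_periodic0 => k.
  rewrite hornerD hornerN hornerZ -r1P -q1P -rP expo_period//.
  by rewrite mulrC subrr.
have [c [T [c0 cT]]] := poly_large q10.
pose x : R := 1 + `|T|.
have x0 : 0 < x by rewrite ltr_wpDr.
have qx : q1.[real_complex R x] != 0.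
  rewrite -cabs_gt0 (lt_le_trans c0)// cT// cabs_real gtr0_norm//.
  by rewrite /x (le_trans (ler_norm T))// lerDr.
have := rP (a + real_complex R x *: b).
rewrite q1P r1P E hornerZ [RHS]mulrC => /(mulfI qx).
rewrite /expo pairingD pairingZ ab mulr1 mulrDl cexpD -[RHS]mulr1 => /(mulfI (cexp_neq0 _)).
move/(congr1 (@cabs R)); rewrite cabs_cexp cabs1 => /eqP.
rewrite -[X in _ == X]expR0 (inj_eq (@expR_inj R)).
have -> : real_complex R x / n%:R = real_complex R (x / n%:R).
  by rewrite rmorphM fmorphV rmorph_nat.
by rewrite /= gt_eqF// divr_gt0// ltr0n.
Qed.

Lemma derive_expo z k :
  is_derive z (delta_mx 0 k : 'rV[C R]_m) expo (alpha 0 k / n%:R * expo z).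
Proof.
rewrite -[X in is_derive X]addr0 -(scale0r (delta_mx 0 k)); apply/cder_lineP.
have E t : expo (z + t *: delta_mx 0 k) = cexp (pairing alpha z / n%:R + t * (alpha 0 k / n%:R)).
  rewrite /expo pairingD pairingZ mulrDl; congr (cexp (_ + _)).
  rewrite -mulrA; congr (t * (_ / _)); rewrite /pairing (bigD1 k)//= big1 ?addr0.
    by rewrite mxE !eqxx mulr1.
  by move=> j jk; rewrite mxE eqxx (negPf jk) mulr0.
apply: cder_eq (cder_comp (cder_affine (pairing alpha z / n%:R) (alpha 0 k / n%:R) 0)
  (cder_cexp _)) => [t|]; first by rewrite E.
by rewrite mul0r addr0 mulrC.
Qed.

(** r is chosen before c: the same polynomial serves every constant multiple of the solution. *)
Lemma pderivm_expsol (nu : mindex m) q : exists r, forall (c : C R) z,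
  pderivm nu (fun z => c * (peval q z * expo z)) z = c * (peval r z * expo z).
Proof.
have [d dP] := choice (fun qk : cpoly R m * 'I_m => pderiv_peval qk.1 qk.2).
pose step (k : 'I_m) r : cpoly R m := d (r, k) + mpoly.mpolyC m (alpha 0 k / n%:R) * r.
have stepP k r (c : C R) : pderiv k (fun z => c * (peval r z * expo z)) =
    (fun z => c * (peval (step k r) z * expo z)).
  apply/funext => z; have [_] : is_derive z (delta_mx 0 k : 'rV[C R]_m)
    (c *: (peval r * expo)) (c *: (peval r z *: (alpha 0 k / n%:R * expo z) +
      expo z *: peval (d (r, k)) z)).
    have D1 := dP (r, k) z; have D2 := derive_expo z k.
    exact: is_deriveZ.
  rewrite /pderiv => ->; rewrite /GRing.scale /= /step pevalD pevalM pevalC.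
  by ring.
exists (foldr (fun k r => iter (nu k) (step k) r) q (enum 'I_m)) => c z.
rewrite /pderivm; elim: (enum _) z => //= k s IH z.
have {}IH := funext IH; rewrite {}IH; move: (foldr _ q s) => r.
suff -> : iter (nu k) (pderiv k) (fun z => c * (peval r z * expo z)) =
  (fun z => c * (peval (iter (nu k) (step k) r) z * expo z)) by [].
by elim: (nu k) => //= j ->; rewrite stepP.
Qed.

Lemma dp_eval_expsol P q : exists h : mindex (dp_N P).+1 -> cpoly R m,
  forall (c : C R) z, dp_eval P (fun z => c * (peval q z * expo z)) z =
    \sum_(i <- dp_I P) peval (h i) z * (c * expo z) ^+ mpoly.mdeg i.
Proof.
have [r rP] := choice (fun j : 'I_(dp_N P) => pderivm_expsol (dp_nu P j) q).
exists (fun i => dp_c P i * q ^+ i ord0 * \prod_(j < dp_N P) r j ^+ i (lift ord0 j)) => c z.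
apply: eq_bigr => i _.
have -> : \prod_(j < dp_N P) pderivm (dp_nu P j) (fun z => c * (peval q z * expo z)) z ^+ i (lift ord0 j) =
   \prod_(j < dp_N P) (peval (r j) z ^+ i (lift ord0 j)) *
   (c * expo z) ^+ (\sum_(j < dp_N P) i (lift ord0 j)).
  rewrite expr_sum -big_split; apply: eq_bigr => j _ /=.
  by rewrite rP mulrCA exprMn.
rewrite mpoly.mdegE big_ord_recl exprD !pevalM pevalXn peval_prod.
under [X in _ = _ * X * _]eq_bigr do rewrite pevalXn.
have -> : (c * (peval q z * expo z)) ^+ i ord0 = peval q z ^+ i ord0 * (c * expo z) ^+ i ord0.
  by rewrite mulrCA exprMn.
by ring.
Qed.

(* Each homogeneous part of P(q e^{L/n}) is a polynomial times a distinct power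
   of e^{L/n}; periodicity decouples the exponential from the polynomials. *)
Lemma dp_eval_scale P q (c : C R) :
  (forall z, dp_eval P (fun z => peval q z * expo z) z = 0) ->
  forall z, dp_eval P (fun z => cexp c * (peval q z * expo z)) z = 0.
Proof.
move=> Pq; have [h hP] := dp_eval_expsol P q.
have [b ab] := direction_ex alpha0.
pose H z x := \sum_(i <- dp_I P) peval (h i) z * x ^+ mpoly.mdeg i.
have H0 z : H z (expo z) = 0.
  have -> : H z (expo z) = H z (1 * expo z) by rewrite mul1r.
  apply: etrans (esym (hP 1 z)) _.
  apply: etrans (Pq z); congr dp_eval.
  by apply/funext => w; rewrite mul1r.
have H1 z t : H (z + t *: b) (expo z) = 0.
  have [g gP] := choice (fun i => peval_line (h i) z b).
  pose G := \sum_(i <- dp_I P) expo z ^+ mpoly.mdeg i *: g i.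
  have HE s : H (z + s *: b) (expo z) = G.[s].
    by rewrite horner_sum; apply: eq_bigr => i _; rewrite hornerZ gP mulrC.
  suff G0 : G = 0 by rewrite HE G0 horner0.
  by apply: poly_periodic0 => k; rewrite -HE -(expo_period z k ab) H0.
move=> z; rewrite hP; change (H z (cexp c * expo z) = 0).
(* Moving the base point by c * n along b produces the factor [cexp c]; [H1] then brings the
   polynomials back to z. *)
have <- : expo (z + (c * n%:R) *: b) = cexp c * expo z.
  by rewrite /expo pairingD pairingZ ab mulr1 mulrDl mulfK// cexpD mulrC.
by have := H1 (z + (c * n%:R) *: b) (- (c * n%:R)); rewrite -addrA -scalerDl subrr scale0r addr0.
Qed.

(** The arc cosine gives the argument on the closed upper half circle; a point below it is the
    inverse of its conjugate. *)
Lemma unit_cexp (c : C R) : cabs c = 1 -> exists d, c = cexp d.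
Proof.
have U (x y : R) : x ^+ 2 + y ^+ 2 = 1 -> 0 <= y -> Complex x y = cexp (Complex 0 (acos x)).
  move=> xy y0; have x1 : -1 <= x <= 1.
    by rewrite -ler_norml -(@ler_sqr R) ?nnegrE// real_normK ?num_real// expr1n -xy lerDl sqr_ge0.
  rewrite /cexp /= expR0 !mul1r acosK// sin_acos//.
  by rewrite -xy addrAC subrr add0r sqrtr_sqr ger0_norm.
case: c => x y c1.
have xy : x ^+ 2 + y ^+ 2 = 1 by rewrite -(expr1n R 2) -c1 cabs_sqr.
have [y0|y0] := leP 0 y; first by exists (Complex 0 (acos x)); exact: U.
have Uy : Complex x (- y) = cexp (Complex 0 (acos x)).
  by apply: U; rewrite ?sqrrN// oppr_ge0 ltW.
exists (- Complex 0 (acos x)); rewrite cexpN -Uy.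
apply: invr_inj; rewrite invrK; apply: (mulfI (_ : (Complex x y : C R) != 0)).
  by rewrite -cabs_gt0 c1.
rewrite mulfV; last by rewrite -cabs_gt0 c1.
by apply/eqP; rewrite eq_complex /=; apply/andP; split; apply/eqP; [rewrite -xy|]; ring.
Qed.

(** Pointwise, the root of unity relating q to r could vary with z. The product of q - c r over all
    roots of unity c vanishes everywhere, and in an integral domain one factor must be 0. *)
Lemma cpoly_roots q r : q ^+ n = r ^+ n -> exists2 c : C R, c ^+ n = 1 & q = mpoly.mpolyC m c * r.
Proof.
move=> qr; have [rs rsE] := closed_field_poly_normal ('X^n - 1 : {poly C R}).
have lc : lead_coef ('X^n - 1 : {poly C R}) = 1 by rewrite lead_coefXnsubC.
rewrite lc scale1r in rsE.
have rsP (c : C R) : (c \in rs) = (c ^+ n == 1).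
  by rewrite -root_prod_XsubC -rsE /root !hornerE subr_eq0.
have : \prod_(c <- rs) (q - mpoly.mpolyC m c * r) = 0.
  apply: cpoly_ext => z; rewrite peval0 peval_prod.
  have qrz : peval q z ^+ n = peval r z ^+ n by rewrite -!pevalXn qr.
  suff [c crs cz] : exists2 c, c \in rs & peval q z = c * peval r z.
    by rewrite (big_rem c)//= pevalB pevalM pevalC cz subrr mul0r.
  have [r0|r0] := eqVneq (peval r z) 0.
    exists 1; first by rewrite rsP expr1n.
    by move/eqP: qrz; rewrite r0 mulr0 expr0n -[n == 0%N]negbK -lt0n n0 expf_eq0 n0 => /eqP.
  exists (peval q z / peval r z); last by rewrite divfK.
  by rewrite rsP expr_div_n qrz divff// expf_neq0.
move/eqP; rewrite prodf_seq_eq0 => /hasP[c crs /= /eqP qc].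
exists c; first by apply/eqP; rewrite -rsP.
by apply/eqP; rewrite -subr_eq0 qc.
Qed.

Lemma cabs_root_of_unity (c : C R) : c ^+ n = 1 -> cabs c = 1.
Proof.
move=> cn; have := cabsX c n; rewrite cn cabs1 => /esym/eqP.
by rewrite pexprn_eq1 ?cabs_ge0// eqn0Ngt n0 /= => /eqP.
Qed.

Lemma dp_eval_expsol_root P q r : q ^+ n = r ^+ n ->
  (forall z, dp_eval P (fun z => peval r z * expo z) z = 0) ->
  forall z, dp_eval P (fun z => peval q z * expo z) z = 0.
Proof.
move=> /cpoly_roots[c /cabs_root_of_unity/unit_cexp[d ->] ->] Pr z.
apply: etrans (dp_eval_scale d Pr z); congr dp_eval.
by apply/funext => w; rewrite pevalM pevalC mulrA.
Qed.

End ExponentialSolutions.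

(** An n-th root of p need not exist, and [fsol q] need not annihilate P, so existence is
    characterised by an equivalence. Once there is one solution, every n-th root of p yields one. *)
Theorem theorem2p1 (R : realType) (m n : nat) (P : diffpoly R m)
    (p : cpoly R m) (alpha : 'rV[C R]_m) :
  (1 <= m)%N -> (3 <= n)%N -> (dp_deg P <= n - 2)%N -> p != 0 -> alpha != 0 ->
  let fsol (q : cpoly R m) (z : 'rV[C R]_m) : C R :=
    peval q z * cexp (pairing alpha z / n%:R) in
  [/\ (exists f, trans_entire_sol n P p alpha f) <->
        (exists q : cpoly R m, q ^+ n = p /\ forall z, dp_eval P (fsol q) z = 0),
      (exists f, trans_entire_sol n P p alpha f) ->
        forall f, trans_entire_sol n P p alpha f <->
          (exists q : cpoly R m, q ^+ n = p /\ forall z, f z = fsol q z) &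
      forall f, trans_entire_sol n P p alpha f -> forall z, dp_eval P f z = 0].
Proof.
move=> _ n3 degP p0 alpha0 fsol.
have [N nE] : exists N, n = N.+2 by exists (n - 2)%N; rewrite -[(n - 2).+2]addn2 subnK// ltnW.
have n0 : (0 < n)%N by rewrite nE.
have degN : (dp_deg P <= N)%N by rewrite nE -addn2 addnK in degP.
have eval0 f : trans_entire_sol n P p alpha f -> forall z, dp_eval P f z = 0.
  by rewrite nE => -[fe _ fE]; exact: forward_dp_eval0 fE.
have sol f : trans_entire_sol n P p alpha f ->
    exists q : cpoly R m, q ^+ n = p /\ forall z, f z = fsol q z.
  by rewrite /fsol nE => -[fe _ fE]; exact: forward_solution fE.
have solE f (q : cpoly R m) : (forall z, f z = fsol q z) -> f = fsol q by move/funext.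
have conv (q : cpoly R m) : q ^+ n = p -> (forall z, dp_eval P (fsol q) z = 0) ->
    trans_entire_sol n P p alpha (fsol q).
  move=> qp Pq; split; first exact: entire_expsol.
    apply: transcendental_expsol => //; apply: contraNneq p0 => q0.
    by rewrite -qp q0 expr0n eqn0Ngt n0.
  move=> z; rewrite Pq addr0 /fsol exprMn cexpX mulrC.
  by rewrite [n%:R * _]mulrC divfK ?pnatr_eq0 -?lt0n// -pevalXn qp mulrC.
split=> //.
- split=> [[f fs]|[q [qp Pq]]]; last by exists (fsol q); exact: conv.
  have [q [qp /solE fq]] := sol f fs; exists q; split=> //.
  by rewrite -fq; exact: eval0.
- move=> [f0 f0s] f; split; first exact: sol.
  move=> [q [qp /solE ->]]; apply: conv => //.
  have [q0 [q0p /solE f0q]] := sol f0 f0s.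
  apply: (dp_eval_expsol_root n0 alpha0 (r := q0)); first by rewrite qp q0p.
  by rewrite -[X in dp_eval P X]f0q; exact: eval0.
Qed.
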